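(* Let $d\ge 1$, $M\in\mathbb{N}$ with $M\ge 2$, $p\in(M^{-d},1]$, and let $F$ be a fractal percolation on $[0,1]^d$ with parameters $M$ and $p$, with construction steps $F_n$, $n\in\mathbb{N}_0$. Then, for each $k\in\{0,\ldots,d\}$, the random variables $Z^k_n:=M^{(k-D)n}V_k(F_n)$ converge almost surely, as $n\to\infty$, to some random variable $Z^k_\infty$. Moreover, $Z^k_\infty$ is given by $$Z^k_\infty=\overline{\mathcal V}_k(F)\cdot W_\infty ,$$ where $\overline{\mathcal V}_k(F)$ is the deterministic limit $\lim_{n\to\infty}M^{n(k-D)}\mathbb{E}V_k(F_n)$ and $W_\infty$ is the almost sure martingale limit $\lim_{n\to\infty}N_n/\mathbb{E}N_n$.
   Context: Fractal percolation: Let $J=[0,1]^d$, $\Sigma=\{1,\ldots,M^d\}$, let $J_1,\ldots,J_{M^d}$ be the $M^d$ closed subcubes of side length $1/M$ into which $J$ is divided, and let $\varphi_j$ be the homothetic (rotation- and reflection-free) similarity mapping $J$ onto $J_j$. For $\sigma=\sigma_1\ldots\sigma_n\in\Sigma^n$ let $J_\sigma=\varphi_{\sigma_1}\circ\cdots\circ\varphi_{\sigma_n}(J)$ (a basic cube of level $n$, of side length $M^{-n}$), and for $m\le n$ let $\sigma|m=\sigma_1\ldots\sigma_m$. Let $\{Y_\sigma:\sigma\in\bigcup_{n\ge1}\Sigma^n\}$ be i.i.d. Bernoulli variables with parameter $p$. Put $F_0=J$ and, for $n\ge1$, let $F_n$ be the union of all $J_\sigma$, $\sigma\in\Sigma^n$,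 with $Y_{\sigma|1}=\cdots=Y_{\sigma|n}=1$ (the retained cubes of level $n$). The fractal percolation is $F=\bigcap_n F_n$. $D:=\log(M^dp)/\log M$, so $M^D=M^dp$. $V_0,\ldots,V_d$ denote the intrinsic volumes, extended additively to finite unions of compact convex sets, with $V_k(\emptyset)=0$. $N_n$ is the number of retained cubes of level $n$ (with $N_0=1$); it is a Galton–Watson process with $\mathrm{Bin}(M^d,p)$ offspring distribution, $\mathbb{E}N_n=(M^dp)^n$, and $W_n:=N_n/\mathbb{E}N_n$ is a nonnegative martingale, with almost sure limit $W_\infty$. It is known that, for every $k\in\{0,\ldots,d\}$ and $p\in(0,1]$, the limit $\overline{\mathcal V}_k(F):=\lim_{n\to\infty}M^{n(k-D)}\mathbb{E}V_k(F_n)$ exists and equals $$V_k([0,1]^d)+\sum_{T\subset\Sigma,\,|T|\ge2}(-1)^{|T|-1}\sum_{n=1}^\infty M^{n(k-D)}\,\mathbb{E}V_k\Big(\bigcap_{j\in T}F_n^j\Big),$$ where $F_n^j$ is the union of those retained cubes $J_\sigma$ of level $n$ with $\sigma|1=j$. *)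

(* Defs.v *)
From HB Require Import structures.
From mathcomp Require Import all_boot all_order all_algebra.
From mathcomp Require Import all_classical all_reals all_analysis.

Set Implicit Arguments.
Unset Strict Implicit.
Unset Printing Implicit Defensive.

Import Order.TTheory GRing.Theory Num.Theory.
Import numFieldNormedType.Exports.

Local Open Scope classical_set_scope.
Local Open Scope ring_scope.

(* [d]-dimensional Lebesgue measure as an iterated product measure: the measure
   [m1 \x m2] of the library is likewise the [m1]-integral of the [m2]-measure
   of sections. Only meaningful on Borel sets; it is applied to compact sets. *)
Fixpoint volume (R : realType) (d : nat) : set 'rV[R]_d -> \bar R :=
  match d with
  | 0 => fun A => (\1_A (0 : 'rV[R]_0))%:E
  | d'.+1 => fun A =>
      (\int[@lebesgue_measure R]_x
        volume [set y : 'rV[R]_d' | A (row_mx (x%:M : 'rV[R]_1) y)])%E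
  end.

(* The library norm on ['rV[R]_d] is the sup norm, hence this definition. *)
Definition eucl_norm (R : realType) (d : nat) (x : 'rV[R]_d) : R :=
  Num.sqrt (\sum_(i < d) x ord0 i ^+ 2).

Definition parallel_set (R : realType) (d : nat) (K : set 'rV[R]_d) (eps : R) :
    set 'rV[R]_d :=
  [set x | exists2 y, K y & eucl_norm (x - y) <= eps].

Definition kappa (R : realType) (n : nat) : R :=
  fine (volume [set x : 'rV[R]_n | eucl_norm x <= 1]).

Definition convex_body (R : realType) (d : nat) (K : set 'rV[R]_d) : Prop :=
  compact K /\ convex_set (K : set (convex_lmodType 'rV[R]_d)).

Definition polyconvex (R : realType) (d : nat) (A : set 'rV[R]_d) : Prop :=
  exists2 s : seq (set 'rV[R]_d),
    (forall K, K \in s -> convex_body K) & A = \big[setU/set0]_(K <- s) K.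

Definition steiner_formula (R : realType) (d : nat) (K : set 'rV[R]_d)
    (v : {ffun 'I_d.+1 -> R}) : Prop :=
  forall eps : R, 0 <= eps ->
    volume (parallel_set K eps) =
    (\sum_(k < d.+1) kappa R (d - k) * v k * eps ^+ (d - k))%:E.

(* Such coefficients are unique, and exist for every convex body; the default
   value 0 is then never used. *)
Definition intrinsic_volume (R : realType) (d : nat) (k : 'I_d.+1)
    (K : set 'rV[R]_d) : R :=
  xget [ffun=> 0] [set v | steiner_formula K v] k.

(* By Groemer's extension theorem such a [V] exists, and by inclusion-exclusion
   its values on polyconvex sets are uniquely determined. *)
Record additive_intrinsic_volumes (R : realType) (d : nat)
    (V : 'I_d.+1 -> set 'rV[R]_d -> R) : Prop := AdditiveIntrinsicVolumes {
  aiv_convex : forall k K, convex_body K -> V k K = intrinsic_volume k K ;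
  aiv_set0 : forall k, V k set0 = 0 ;
  aiv_additive : forall k A B, polyconvex A -> polyconvex B ->
    V k (A `|` B) + V k (A `&` B) = V k A + V k B }.

(* The alphabet {1, ..., M^d}: a letter is the position, in each coordinate, of
   one of the M^d subcubes of the unit cube. *)
Definition letter (d M : nat) := {ffun 'I_d -> 'I_M}.

Definition unit_cube (R : realType) (d : nat) : set 'rV[R]_d :=
  [set x | forall i, 0 <= x ord0 i <= 1].

Definition phi (R : realType) (d M : nat) (j : letter d M) (x : 'rV[R]_d) :
    'rV[R]_d :=
  \row_i ((x ord0 i + (j i)%:R) / M%:R).

Definition basic_cube (R : realType) (d M : nat) (s : seq (letter d M)) :
    set 'rV[R]_d :=
  foldr (fun j A => phi j @` A) (@unit_cube R d) s.

Definition mutually_independent (disp : measure_display)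
    (T : measurableType disp) (R : realType) (P : probability T R)
    (disp' : measure_display) (T' : measurableType disp') (I : choiceType)
    (J : set I) (X : I -> {RV P >-> T'}) : Prop :=
  forall (l : seq I) (B : I -> set T'), uniq l ->
    (forall i, i \in l -> J i) -> (forall i, measurable (B i)) ->
    P (\big[setI/setT]_(i <- l) (X i @^-1` B i)) =
    (\prod_(i <- l) P (X i @^-1` B i))%E.

(* Only the variables indexed by nonempty words matter. *)
Definition iid_bernoulli (disp : measure_display) (T : measurableType disp)
    (R : realType) (P : probability T R) (d M : nat) (p : R)
    (Y : seq (letter d M) -> {RV P >-> bool}) : Prop :=
  (forall s, s != [::] ->
     forall B, distribution P (Y s) B = bernoulli_prob p B) /\
  mutually_independent [set s | s != [::]] Y.

Section percolation.
Context (disp : measure_display) (T : measurableType disp) (R : realType).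
Context (P : probability T R) (d M : nat).
Context (Y : seq (letter d M) -> {RV P >-> bool}).

Definition retained (s : seq (letter d M)) (w : T) : bool :=
  all (fun m => Y (take m s) w) (iota 1 (size s)).

Definition F_step (n : nat) (w : T) : set 'rV[R]_d :=
  \bigcup_(s in [set s : n.-tuple (letter d M) | retained s w])
    basic_cube s.

Definition N_retained (n : nat) (w : T) : R :=
  #|[pred s : n.-tuple (letter d M) | retained s w]|%:R.

Definition W_mart (n : nat) (w : T) : R :=
  N_retained n w / fine 'E_P[N_retained n].

Definition W_infty (w : T) : R := limn (W_mart ^~ w).

End percolation.

Definition dimD (R : realType) (d M : nat) (p : R) : R :=
  ln (M%:R ^+ d * p) / ln M%:R.

Section rescaled.
Context (disp : measure_display) (T : measurableType disp) (R : realType).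
Context (P : probability T R) (d M : nat) (p : R).
Context (Y : seq (letter d M) -> {RV P >-> bool}).
Context (V : 'I_d.+1 -> set 'rV[R]_d -> R) (k : 'I_d.+1).

Definition Z_rescaled (n : nat) (w : T) : R :=
  M%:R `^ ((k%:R - dimD d M p) * n%:R) * V k (F_step Y n w).

Definition mean_rescaled (n : nat) : R :=
  M%:R `^ (n%:R * (k%:R - dimD d M p)) *
  fine 'E_P[fun w => V k (F_step Y n w)].

Definition Vbar : R := limn mean_rescaled.

End rescaled.

(* Main.v *)
(* Homotheties act on intrinsic volumes by powers of the ratio, because the
   Steiner coefficients are unique, and an additive functional is determined on
   unions of lattice cubes up to such homotheties.  Let X_n be V_k of the
   n-th step rescaled to unit lattice cubes, and mu = M^d p.  By additivity,
   X_{n+1} is the sum of the copies of X_n attached to the retained cubes of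
   level 1, up to an error which is at most a constant times the number of
   retained cubes lying on the boundary of a cube of level 1: up to translation
   there are only finitely many unions of faces of a unit cube.  Boundary cubes
   form branching processes of mean M^{d-1} p, so after division by mu^n the
   error decays geometrically in L^2.  The centred variables
   U_n = mu^-n X_n - E(mu^-n X_n) W_n then satisfy
   U_{n+1} = mu^-1 (sum of independent centred copies of U_n) + small error,
   whence E U_{n+1}^2 <= a E U_n^2 + C rho^n with a, rho < 1.  Thus E U_n^2 is
   summable and U_n -> 0 almost surely; the same recursion without error, applied
   to W_{n+1} - W_n, gives the convergence of W_n.  All these means are finite
   sums over the finitely many trees of bits of height n. *)
Require Import Defs.
From HB Require Import structures.
From mathcomp Require Import all_boot all_order all_algebra.
From mathcomp Require Import all_classical all_reals all_analysis.
From mathcomp Require Import measurable_realfun ring lra zify.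

Set Implicit Arguments.
Unset Strict Implicit.
Unset Printing Implicit Defensive.

Import Order.TTheory GRing.Theory Num.Theory.
Import numFieldNormedType.Exports.

Local Open Scope classical_set_scope.
Local Open Scope ring_scope.

(** * Volume and Steiner coefficients under homotheties *)

(* The slice volumes integrated in [volume] are not known to be measurable, so
   integrals are handled as suprema of integrals of simple functions. *)
Section integral_without_measurability.
Local Open Scope ereal_scope.
Import HBNNSimple.

Lemma ge0_le_integralT disp (T : measurableType disp) (R : realType)
    (mu : {measure set T -> \bar R}) (f g : T -> \bar R) :
  (forall x, 0 <= f x) -> (forall x, f x <= g x) ->
  \int[mu]_x f x <= \int[mu]_x g x.
Proof.
move=> f0 fg; have g0 x : 0 <= g x by exact: le_trans (f0 x) (fg x).
rewrite !ge0_integralTE// ge_ereal_sup// => _ [h /= hf <-].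
by apply: ereal_sup_ubound; exists h => //= x; exact: le_trans (hf x) (fg x).
Qed.

(** Scaling the simple functions below [f] gives one inequality for every positive factor; the
    converse is that inequality for the factor [c^-1]. *)
Lemma ge0_integralZlT disp (T : measurableType disp) (R : realType)
    (mu : {measure set T -> \bar R}) (c : R) (f : T -> \bar R) :
  (0 < c)%R -> (forall x, 0 <= f x) ->
  \int[mu]_x (c%:E * f x) = c%:E * \int[mu]_x f x.
Proof.
have le_half (e : R) (g : T -> \bar R) : (0 < e)%R -> (forall x, 0 <= g x) ->
    e%:E * \int[mu]_x g x <= \int[mu]_x (e%:E * g x).
  move=> e0 g0; rewrite -lee_pdivlMl// ge0_integralTE//.
  apply: ge_ereal_sup => _ [h /= hg <-]; rewrite lee_pdivlMl//.
  rewrite -sintegralrM ge0_integralTE; last first.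
    by move=> x; rewrite mule_ge0// lee_fin ltW.
  apply: ereal_sup_ubound; exists (scale_nnsfun h (ltW e0)) => //= x.
  by rewrite EFinM lee_pmul2l ?fin_numE.
move=> c0 f0; apply/eqP; rewrite eq_le le_half// andbT.
rewrite -lee_pdivrMl//; apply: le_trans (le_half c^-1%R _ _ _) _.
- by rewrite invr_gt0.
- by move=> x; rewrite mule_ge0// lee_fin ltW.
apply: ge0_le_integralT => x; first by rewrite !mule_ge0// lee_fin ?invr_ge0 ltW.
by rewrite muleA -EFinM mulVf ?gt_eqF// mul1e.
Qed.

Section affine_map.
Variables (R : realType) (a b : R).
Hypothesis a0 : (0 < a)%R.

Let affine (x : measurableTypeR R) : measurableTypeR R := (a * x + b)%R.

Let measurable_affine : measurable_fun setT affine.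
Proof. by apply: measurable_funD => //; exact: measurable_funM. Qed.

(** The image of Lebesgue measure under the affine map, multiplied by [a], agrees with Lebesgue
    measure on half-open intervals; uniqueness does the rest. *)
Lemma lebesgue_measure_affine (A : set (measurableTypeR R)) : measurable A ->
  lebesgue_measure (affine @^-1` A) = a^-1%:E * lebesgue_measure A.
Proof.
move=> mA; rewrite -[LHS]mul1e -(mulVf (lt0r_neq0 a0)) EFinM -muleA; congr (_ * _).
have := @lebesgue_measure_unique R
  (mscale (NngNum (ltW a0)) (pushforward (@lebesgue_measure R) affine)).
rewrite /mscale/= /pushforward => /(_ measurable_affine _ _ mA) -> //.
move=> _ [[u v] /= _ <-].
transitivity (a%:E * @lebesgue_measure R `](u - b) / a, (v - b) / a]%classic%R).
  rewrite !lebesgue_measure_itv/= !lte_fin ltr_pM2r ?invr_gt0// ltrD2r.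
  case: ifP => _; last by rewrite mule0.
  by rewrite -!EFinB -EFinM; congr (_%:E); field; rewrite gt_eqF.
congr (_ * lebesgue_measure _).
apply/seteqP; split=> x /=; rewrite !in_itv/= ltr_pdivrMr// ler_pdivlMr//;
  by rewrite ltrBlDr lerBrDr /affine [(x * a)%R]mulrC.
Qed.

(** A simple function below [g], composed with the affine map, is a simple function below the
    composed integrand; [g] itself need not be measurable. *)
Lemma ge0_integral_affineT (g : R -> \bar R) : (forall x, 0 <= g x) ->
  a%:E * \int[lebesgue_measure]_x g (a * x + b)%R >= \int[lebesgue_measure]_x g x.
Proof.
move=> g0; rewrite -lee_pdivrMl// ge0_integralTE// lee_pdivrMl//.
apply: ge_ereal_sup => _ [h /= hg <-]; rewrite -lee_pdivrMl//.
have fh : finite_set (range (h \o affine)).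
  by apply: sub_finite_set (@fimfunP _ _ h) => _ [x _ <-]; exists (affine x).
have mh : measurable_fun setT (h \o affine) by exact: measurableT_comp.
have h0 x : (0 <= (h \o affine) x)%R by exact: fun_ge0.
pose h' : {nnsfun measurableTypeR R >-> R} := HB.pack (h \o affine)
  (isMeasurableFun.Build _ _ _ _ (h \o affine) mh)
  (FiniteImage.Build _ _ (h \o affine) fh)
  (isNonNegFun.Build _ _ (h \o affine) h0).
rewrite (_ : _ * _ = sintegral lebesgue_measure h').
  rewrite ge0_integralTE//; apply: ereal_sup_ubound; exists h' => [x|]; last by [].
  exact: (hg (affine x)).
rewrite !sintegralET ge0_mule_fsumr; last exact: nnsfun_mulemu_ge0.
by apply: eq_fsbigr => x _; rewrite [(h' @^-1` _)]comp_preimage lebesgue_measure_affine// muleCA.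
Qed.

End affine_map.

Lemma ge0_integral_affine (R : realType) (a b : R) (g : R -> \bar R) :
  (0 < a)%R -> (forall x, 0 <= g x) ->
  \int[lebesgue_measure]_x g (a * x + b)%R =
  a^-1%:E * \int[lebesgue_measure]_x g x.
Proof.
move=> a0 g0; apply/eqP; rewrite eq_le; apply/andP; split; last first.
  by rewrite lee_pdivrMl// ge0_integral_affineT.
have ai : (0 < a^-1)%R by rewrite invr_gt0.
(* The remaining inequality is the previous lemma for the inverse affine map. *)
apply: le_trans (ge0_integral_affineT (- b / a)%R ai _) _ => //.
rewrite lee_pmul2l ?fin_numE ?lte_fin//; apply: ge0_le_integralT => // x.
by rewrite (_ : (a * _ + b = x)%R)//; field; rewrite gt_eqF.
Qed.

End integral_without_measurability.

Section volume_theory.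
Variable R : realType.

Lemma volume_ge0 d (A : set 'rV[R]_d) : (0 <= volume A)%E.
Proof.
elim: d A => [|d IHd] A /=; first by rewrite lee_fin.
by apply: integral_ge0 => x _; exact: IHd.
Qed.

Lemma le_volume d (A B : set 'rV[R]_d) : A `<=` B -> (volume A <= volume B)%E.
Proof.
elim: d A B => [|d IHd] A B AB /=.
  rewrite lee_fin !indicE; case: (boolP (_ \in A)) => // /[!inE] /AB.
  by move=> /mem_set ->.
by apply: ge0_le_integralT => x; [exact: volume_ge0|apply: IHd => y /= /AB].
Qed.

(** A slice of the preimage is the preimage of a slice under a homothety in one dimension less, so
    every coordinate contributes a factor [a^-1]. *)
Lemma volume_homothety d (a : R) (b : 'rV[R]_d) (A : set 'rV[R]_d) : 0 < a ->
  volume [set x | A (a *: x + b)] = ((a ^- d)%:E * volume A)%E.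
Proof.
move=> a0; elim: d b A => [|d IHd] b A /=.
  rewrite expr0 invr1 mul1e !indicE; congr (nat_of_bool _)%:R%:E.
  by apply/idP/idP; rewrite !inE/= [a *: 0 + b]thinmx0.
set b0 := b ord0 ord0; set b' : 'rV_d := \row_j b ord0 (lift ord0 j).
transitivity (\int[@lebesgue_measure R]_x ((a ^- d)%:E *
    volume [set y : 'rV[R]_d | A (row_mx ((a * x + b0)%:M : 'rV[R]_1) y)]))%E.
  apply: eq_integral => x _; rewrite -(IHd b'); congr volume.
  apply/funext => y /=; congr A; apply/rowP => j; rewrite !mxE.
  case: splitP => k /= jk; rewrite !mxE.
    by rewrite ord1 !mulr1n (_ : j = 0)//; apply/val_inj; rewrite /= jk ord1.
  by congr (_ + b ord0 _); exact/val_inj.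
rewrite ge0_integralZlT ?invr_gt0 ?exprn_gt0//; last by move=> x; exact: volume_ge0.
rewrite (@ge0_integral_affine R a b0 (fun x =>
  volume [set y : 'rV[R]_d | A (row_mx (x%:M : 'rV[R]_1) y)]))//; last first.
  by move=> x; exact: volume_ge0.
by rewrite muleA -EFinM -invfM exprSr.
Qed.

End volume_theory.
Definition sup_ball (R : realType) d (c : R) : set 'rV[R]_d := [set x | forall i, `|x ord0 i| <= c].

Lemma volume_sup_ball (R : realType) d (c : R) : 0 <= c ->
  volume (@sup_ball R d c) = ((2 * c) ^+ d)%:E.
Proof.
move=> c0; elim: d => [|d IHd].
  by rewrite /= indicE mem_set// => -[].
transitivity (\int[@lebesgue_measure R]_x
    ((2 * c) ^+ d * \1_`[- c, c] x)%:E)%E; last first.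
  under eq_integral do rewrite EFinM.
  rewrite ge0_integralZl//=; last 2 first.
  - exact/measurable_EFinP.
  - by rewrite lee_fin exprn_ge0// mulr_ge0.
  rewrite integral_indic//= setIT lebesgue_measure_itv/= lte_fin.
  case: ltP => [_|]; first by rewrite -EFinD -EFinM exprSr opprK mulr_natl.
  rewrite lerNr => cN; have -> : c = 0 by apply/eqP; rewrite eq_le c0 andbT; lra.
  by rewrite mule0 mulr0 expr0n.
rewrite /=; apply: eq_integral => x _.
have [xc|xc] := boolP (x \in `[- c, c]); last first.
  rewrite indicE memNset ?mulr0//; last by apply/negP.
  apply/eqP; rewrite eq_le volume_ge0 andbT.
  have : (volume (set0 : set 'rV[R]_d) = 0)%E.
    elim: d {IHd} => [|d IHd] /=; first by rewrite indicE in_set0.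
    by rewrite integral0_eq.
  move=> v0; apply: (@le_trans _ _ (volume (set0 : set (matrix R 1 d)))); last by rewrite v0.
  apply: le_volume => y /= /(_ ord0); rewrite mxE.
  case: splitP => // k _; rewrite mxE [k]ord1 mulr1n ler_norml => h.
  by move: xc; rewrite in_itv/= h.
rewrite indicE mem_set// mulr1 -IHd; congr volume; apply/seteqP; split=> y /= h i.
  have := h (lift ord0 i); rewrite mxE; case: splitP => [k|k [/val_inj <-]] // ik.
  by have := ltn_ord k; rewrite -ik.
rewrite mxE; case: splitP => k _ //; rewrite mxE [k]ord1 mulr1n ler_norml.
by move: xc; rewrite in_itv.
Qed.

(** The Euclidean unit ball lies between two cubes of positive finite volume. Finiteness matters
    too, since [fine] sends infinity to 0. *)
Lemma kappa_neq0 (R : realType) d : kappa R d != 0.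
Proof.
pose B := [set x : 'rV[R]_d | eucl_norm x <= 1].
have le1 : (volume B <= volume (@sup_ball R d 1))%E.
  apply: le_volume => x /= x1 i; rewrite -sqrtr_sqr; apply: le_trans x1.
  rewrite ler_sqrt ?sumr_ge0// => [|j _]; last exact: sqr_ge0.
  by rewrite (bigD1 i)//= lerDl sumr_ge0// => j _; exact: sqr_ge0.
(* With half-side [1/(d+1)] the sum of [d] squares is at most [d/(d+1)]; the successor also covers
   [d = 0]. *)
have ge1 : (volume (@sup_ball R d d.+1%:R^-1) <= volume B)%E.
  apply: le_volume => x /= xd; rewrite /B/= /eucl_norm -[leRHS]sqrtr1 ler_sqrt//.
  apply: (@le_trans _ _ (\sum_(i < d) d.+1%:R^-1)).
    apply: ler_sum => i _; rewrite -real_normK ?num_real//.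
    apply: (@le_trans _ _ (d.+1%:R^-1 ^+ 2)); first by rewrite lerXn2r ?nnegrE.
    by rewrite expr2 ler_piMl// invf_le1// ler1n.
  by rewrite sumr_const card_ord -[leLHS]mulr_natl ler_pdivrMr// mul1r ler_nat.
rewrite volume_sup_ball// in le1; rewrite volume_sup_ball ?invr_ge0// in ge1.
rewrite /kappa -/B gt_eqF// fine_gt0//; apply/andP; split.
  by apply: lt_le_trans ge1; rewrite lte_fin exprn_gt0// mulr_gt0.
by apply: le_lt_trans le1 _; exact: ltry.
Qed.


(** The difference of the two Steiner polynomials has degree at most [d] and vanishes at the [d+1]
    points [0, ..., d]; [kappa_neq0] then isolates the coefficients. *)
Lemma steiner_formula_unique (R : realType) d (K : set 'rV[R]_d) v w :
  steiner_formula K v -> steiner_formula K w -> v = w.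
Proof.
move=> Kv Kw; apply/ffunP => k; apply/eqP; rewrite -subr_eq0.
pose p := \poly_(i < d.+1) (kappa R i * (v (inord (d - i)) - w (inord (d - i)))).
have root_p (eps : R) : 0 <= eps -> root p eps.
  move=> eps0; apply/eqP; rewrite horner_poly.
  have /eqP := Kv _ eps0; rewrite Kw// eqe -subr_eq0 -sumrB => /eqP E.
  rewrite (reindex_inj rev_ord_inj)/= -[RHS]oppr0 -[in RHS]E -sumrN.
  apply: eq_bigr => i _; rewrite subSS subKn ?leq_ord// inord_val; ring.
have p0 : p = 0.
  apply/eqP; apply: contraT => pn0.
  have := @max_poly_roots _ p [seq i%:R | i <- iota 0 d.+1] pn0.
  rewrite size_map size_iota ltnNge size_poly; apply.
    by apply/allP => _ /mapP[i _ ->]; exact: root_p.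
  by rewrite map_inj_uniq ?iota_uniq// => i j /eqP; rewrite eqr_nat => /eqP.
have /eqP := congr1 (fun q : {poly R} => q`_(d - k)) p0.
rewrite coef0 coef_poly ltnS leq_subr subKn ?leq_ord// inord_val mulf_eq0.
by rewrite (negbTE (kappa_neq0 _ _)).
Qed.

(** The parallel set of the preimage at distance [eps] is the preimage of the parallel set at
    distance [a * eps], so both sides can be compared power by power. *)
Lemma steiner_formula_homothety (R : realType) d (K : set 'rV[R]_d)
    (a : R) (b : 'rV[R]_d) v : 0 < a -> steiner_formula K v ->
  steiner_formula [set x | K (a *: x + b)] [ffun k : 'I_d.+1 => a ^- k * v k].
Proof.
move=> a0 Kv eps eps0; have an0 : a != 0 by rewrite gt_eqF.
have norm_scale (x : 'rV[R]_d) : eucl_norm (a *: x) = a * eucl_norm x.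
  rewrite -[a in RHS]gtr0_norm// -sqrtr_sqr -sqrtrM ?sqr_ge0// mulr_sumr.
  by congr Num.sqrt; apply: eq_bigr => i _; rewrite mxE exprMn.
transitivity (volume [set x | parallel_set K (a * eps) (a *: x + b)]).
  congr volume; apply/seteqP; split=> x [y /= Ky xy].
    exists (a *: y + b) => //; rewrite opprD addrACA subrr addr0 -scalerBr.
    by rewrite norm_scale ler_pM2l.
  exists (a^-1 *: (y - b)) => /=; first by rewrite scalerA divff// scale1r subrK.
  rewrite -(ler_pM2l a0) -norm_scale scalerBr scalerA divff// scale1r.
  by rewrite opprB addrA.
have ae0 : 0 <= a * eps by rewrite mulr_ge0// ltW.
rewrite volume_homothety// (Kv _ ae0) -EFinM; congr EFin.
rewrite mulr_sumr; apply: eq_bigr => k _; rewrite ffunE exprMn.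
have -> : a ^- d = a ^- k * a ^- (d - k) by rewrite -invfM -exprD subnKC ?leq_ord.
have : a ^+ (d - k) != 0 by rewrite expf_neq0.
have : a ^+ k != 0 by rewrite expf_neq0.
by move: (a ^+ k) (a ^+ (d - k)) => s t s0 t0; field; rewrite s0 t0.
Qed.

(* If [K] has no Steiner coefficients, both sides are the default value 0, so
   that the existence of the Steiner formula is not needed. *)
Lemma intrinsic_volume_homothety (R : realType) d (k : 'I_d.+1)
    (K : set 'rV[R]_d) (a : R) (b : 'rV[R]_d) : 0 < a ->
  intrinsic_volume k [set x | K (a *: x + b)] = a ^- k * intrinsic_volume k K.
Proof.
move=> a0; have an0 : a != 0 by rewrite gt_eqF.
have [[v Kv]|noK] := pselect (exists v, steiner_formula K v).
  have Kv' := steiner_formula_homothety b a0 Kv.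
  rewrite /intrinsic_volume (xget_subset1 _ Kv'); last first.
    by move=> v1 v2; exact: steiner_formula_unique.
  rewrite (xget_subset1 _ Kv) ?ffunE//.
  by move=> v1 v2; exact: steiner_formula_unique.
rewrite /intrinsic_volume !xgetPN ?ffunE ?mulr0// => v Kv; apply: noK.
  by exists v.
have ai : 0 < a^-1 by rewrite invr_gt0.
have := steiner_formula_homothety (- (a^-1 *: b)) ai Kv.
set v' := [ffun _ => _] => Kv'; exists v'; move: Kv'; congr (steiner_formula _ v').
by apply/funext => x /=; rewrite scalerBr scalerA divff// scale1r scalerA divff// scale1r subrK.
Qed.

(** * Polyconvex sets and the additive extension of intrinsic volumes *)

Section polyconvex_sets.
Variables (R : realType) (d : nat).
Implicit Types (A B K L : set 'rV[R]_d).

Lemma convex_bodyI K L : convex_body K -> convex_body L -> convex_body (K `&` L).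
Proof.
move=> [cK vK] [cL vL]; split.
  rewrite setIC; apply: compact_closedI => //; apply: compact_closed => //.
move=> x y l /set_mem[Kx Lx] /set_mem[Ky Ly]; apply/mem_set; split; apply/set_mem.
  by apply: vK; exact/mem_set.
by apply: vL; exact/mem_set.
Qed.

Lemma convex_body_homothety (a : R) (b : 'rV[R]_d) K : 0 < a ->
  convex_body K -> convex_body [set x | K (a *: x + b)].
Proof.
move=> a0 [cK vK]; have an0 : a != 0 by rewrite gt_eqF.
split.
  rewrite (_ : mkset _ = (fun x => a^-1 *: (x - b)) @` K).
    apply: continuous_compact => //; apply: continuous_subspaceT => x.
    apply: (@cvgZ _ 'rV[R]_d _ (nbhs x) _ (fun=> a^-1) (fun x => x - b)); first exact: cvg_cst.
    by apply: (@cvgB _ 'rV[R]_d); [exact: cvg_id|exact: cvg_cst].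
  apply/seteqP; split => x /=.
    by move=> Kx; exists (a *: x + b) => //; rewrite addrK scalerA mulVf// scale1r.
  by move=> [y Ky <-]; rewrite scalerA divff// scale1r subrK.
move=> x y l /set_mem/= Kx /set_mem/= Ky; apply/mem_set.
have /set_mem := vK _ _ l (mem_set Kx) (mem_set Ky); congr K; rewrite /conv /=.
rewrite !scalerDr addrACA -scalerDl (_ : l%:num + _ = 1) ?scale1r; last exact: subrKC.
congr (_ + _).
by rewrite !scalerA ![_ * a]mulrC.
Qed.

Lemma polyconvexP A : polyconvex A <-> exists2 s : seq (set 'rV[R]_d),
  (forall K, K \in s -> convex_body K) & A = \bigcup_(K in [set` s]) K.
Proof. by split=> -[s sK ->]; exists s => //; rewrite bigcup_seq. Qed.

Lemma convex_body_polyconvex K : convex_body K -> polyconvex K.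
Proof.
by move=> cK; exists [:: K] => [L|]; [rewrite inE => /eqP ->|rewrite big_seq1].
Qed.

Lemma polyconvex0 : polyconvex (set0 : set 'rV[R]_d).
Proof. by exists [::] => //; rewrite big_nil. Qed.

Lemma polyconvexU A B : polyconvex A -> polyconvex B -> polyconvex (A `|` B).
Proof.
move=> [s sK ->] [t tK ->]; exists (s ++ t); last by rewrite big_cat.
by move=> K; rewrite mem_cat => /orP[/sK|/tK].
Qed.

Lemma polyconvexI A B : polyconvex A -> polyconvex B -> polyconvex (A `&` B).
Proof.
move=> /polyconvexP[s sK ->] /polyconvexP[t tK ->].
apply/polyconvexP; exists [seq K `&` L | K <- s, L <- t].
  by move=> _ /allpairsP[[K L] /= [/sK ? /tK ? ->]]; exact: convex_bodyI.
apply/seteqP; split=> x.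
  move=> [[K sKK Kx] [L tL Lx]]; exists (K `&` L) => //=.
  exact: allpairs_f.
by move=> [_ /allpairsP[[K L] /= [Ks Lt ->]] [Kx Lx]]; split; [exists K|exists L].
Qed.

Lemma polyconvex_bigsetU (I : eqType) (s : seq I) (P : pred I) (F : I -> set 'rV[R]_d) :
  (forall i, i \in s -> P i -> polyconvex (F i)) -> polyconvex (\big[setU/set0]_(i <- s | P i) F i).
Proof.
move=> sF; rewrite big_seq_cond; apply: big_ind; first exact: polyconvex0.
  exact: polyconvexU.
by move=> i /andP[]; exact: sF.
Qed.

Lemma polyconvex_homothety (a : R) (b : 'rV[R]_d) A : 0 < a ->
  polyconvex A -> polyconvex [set x | A (a *: x + b)].
Proof.
move=> a0 /polyconvexP[s sK ->]; apply/polyconvexP.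
exists [seq [set x | K (a *: x + b)] | K <- s].
  by move=> _ /mapP[K /sK cK ->]; exact: convex_body_homothety.
apply/seteqP; split=> x.
  by move=> [K Ks Kx]; exists [set x | K (a *: x + b)] => //=; apply/mapP; exists K.
by move=> [_ /mapP[K Ks ->] Kx]; exists K.
Qed.

Variables (V : 'I_d.+1 -> set 'rV[R]_d -> R).
Hypothesis hV : additive_intrinsic_volumes V.

Lemma additive_intrinsic_volumesU k A B : polyconvex A -> polyconvex B ->
  V k (A `|` B) = V k A + V k B - V k (A `&` B).
Proof. by move=> pA pB; rewrite -(aiv_additive hV) // addrK. Qed.

(** Induction on the number of bodies: once [K] is split off, both the rest and its trace on [K] are
    unions of fewer bodies, and additivity leaves only the case of one body. *)
Lemma additive_intrinsic_volumes_homothety k B (a : R) (b : 'rV[R]_d) :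
  0 < a -> polyconvex B -> V k [set x | B (a *: x + b)] = a ^- k * V k B.
Proof.
move=> a0 [s sK ->].
have [n] := ubnP (size s); elim: n s sK => // n IHn [|K s] sK /=; rewrite ltnS => ns.
  by rewrite big_nil (_ : mkset _ = set0)// (aiv_set0 hV) mulr0.
have cK : convex_body K by apply: sK; rewrite mem_head.
have {}sK L : L \in s -> convex_body L by move=> Ls; apply: sK; rewrite inE Ls orbT.
set A := \big[setU/set0]_(L <- s) L.
have pA : polyconvex A by exists s.
have IA : K `&` A = \big[setU/set0]_(L <- [seq K `&` L | L <- s]) L.
  by rewrite big_map big_distrr.
rewrite big_cons -/A additive_intrinsic_volumesU//; last exact: convex_body_polyconvex.
rewrite (_ : mkset _ = [set x | K (a *: x + b)] `|` [set x | A (a *: x + b)])//.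
rewrite additive_intrinsic_volumesU//; last 2 first.
- by apply: convex_body_polyconvex; exact: convex_body_homothety.
- exact: polyconvex_homothety.
rewrite (_ : _ `&` _ = [set x | (K `&` A) (a *: x + b)])// IA.
have -> : V k [set x | A (a *: x + b)] = a ^- k * V k A by exact: IHn.
rewrite IHn//; last 2 first.
- by move=> _ /mapP[L Ls ->]; apply: convex_bodyI => //; exact: sK.
- by rewrite size_map.
rewrite (aiv_convex hV); last exact: convex_body_homothety.
by rewrite intrinsic_volume_homothety// (aiv_convex hV k cK) mulrBr mulrDr.
Qed.

End polyconvex_sets.

(** * Valuations of unions of lattice cubes *)

Section lattice_cells.
Variables (R : realType) (d : nat).
Implicit Types (A B G X : set 'rV[R]_d) (x y : 'rV[R]_d) (z : {ffun 'I_d -> nat}).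

Definition lattice_cube z : set 'rV[R]_d :=
  [set x | forall i, (z i)%:R <= x ord0 i <= (z i)%:R + 1].

(** For points with nonnegative coordinates, these comparisons say that both lie in the same
    relatively open face of the unit lattice. *)
Definition same_cell x y := forall i (m : nat),
  (m%:R <= x ord0 i) = (m%:R <= y ord0 i) /\ (x ord0 i <= m%:R) = (y ord0 i <= m%:R).

(* [saturated A]: [A] is a union of relatively open faces of the unit lattice. *)
Definition saturated A := forall x y, same_cell x y -> A x -> A y.

Lemma saturatedI A B : saturated A -> saturated B -> saturated (A `&` B).
Proof. by move=> sA sB x y xy [/(sA _ _ xy) ? /(sB _ _ xy)]. Qed.

Lemma saturatedU A B : saturated A -> saturated B -> saturated (A `|` B).
Proof. by move=> sA sB x y xy [/(sA _ _ xy)|/(sB _ _ xy)]; [left|right]. Qed.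

Lemma saturated_bigsetU (I : Type) (s : seq I) (P : pred I) (F : I -> set 'rV[R]_d) :
  (forall i, P i -> saturated (F i)) -> saturated (\big[setU/set0]_(i <- s | P i) F i).
Proof. by move=> sF; apply: big_ind => //; exact: saturatedU. Qed.

Lemma saturated_lattice_cube z : saturated (lattice_cube z).
Proof.
move=> x y xy xz i; have := xz i; rewrite !natr1.
have [<- _] := xy i (z i); by have [_ <-] := xy i (z i).+1.
Qed.

Lemma convex_body_lattice_cube z : convex_body (lattice_cube z).
Proof.
split.
  rewrite (_ : lattice_cube z =
    [set v : 'rV[R]_d | forall i, `[(z i)%:R, (z i)%:R + 1]%classic (v ord0 i)]).
    by apply: (@rV_compact _ d (fun i => `[_, _]%classic)) => i; exact: segment_compact.
  by apply/seteqP; split=> x xz i; have := xz i; rewrite /= in_itv.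
move=> x y l /set_mem xz /set_mem yz; apply/mem_set => i.
have /andP[x0 x1] := xz i; have /andP[y0 y1] := yz i.
have l0 : 0 <= l%:num by [].
have l1 : 0 <= 1 - l%:num by rewrite subr_ge0.
have -> : (conv l x y : 'rV[R]_d) ord0 i =
    l%:num * (x : 'rV[R]_d) ord0 i + (1 - l%:num) * (y : 'rV[R]_d) ord0 i.
  by rewrite /conv/= !mxE.
move: (l%:num) l0 l1 => r r0 r1; apply/andP; split; nra.
Qed.

(** Inside the unit cube, these pairs name the relatively open face that contains [x]. *)
Definition cell_signature x : {ffun 'I_d -> bool * bool} :=
  [ffun i => (x ord0 i == 0, x ord0 i == 1)].

Definition cell_union (S : {set {ffun 'I_d -> bool * bool}}) : set 'rV[R]_d :=
  [set x | lattice_cube [ffun=> 0%N] x /\ cell_signature x \in S].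

Definition nat_row z : 'rV[R]_d := \row_i (z i)%:R.

(** In the cube with lower corner [z], only comparisons with [z i] and [z i + 1] can separate two
    points, and the signature records when these bounds are attained. *)
Lemma same_cell_signature z x y :
  lattice_cube [ffun=> 0%N] x -> lattice_cube [ffun=> 0%N] y ->
  cell_signature x = cell_signature y ->
  same_cell (x + nat_row z) (y + nat_row z).
Proof.
move=> x01 y01 /ffunP xy i m; move: (x01 i) (y01 i) (xy i); rewrite !ffunE !mxE add0r.
move: (x ord0 i) (y ord0 i) (z i) => a b n /andP[a0 a1] /andP[b0 b1] [ab0 ab1].
split.
  have [mn|nm] := leqP m n.
    have le : (m%:R : R) <= n%:R by rewrite ler_nat.
    by apply/idP/idP; lra.
  have := nm; rewrite leq_eqVlt => /predU1P[<-|nm2].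
    by rewrite -!natr1 ![_ + n%:R]addrC !lerD2l !(le_eqVlt 1) ![1 == _]eq_sym ab1 !ltNge a1 b1 !orbF.
  have le : (n%:R + 1 + 1: R) <= m%:R by rewrite !natr1 ler_nat.
  by apply/idP/idP; lra.
have [mn|nm] := ltnP m n.
  have le : (m%:R + 1 : R) <= n%:R by rewrite natr1 ler_nat.
  by apply/idP/idP; lra.
have := nm; rewrite leq_eqVlt => /predU1P[<-|nm2].
  by rewrite !gerDr !(le_eqVlt _ 0) ab0 !ltNge a0 b0 !orbF.
have le : (n%:R + 1 : R) <= m%:R by rewrite natr1 ler_nat.
by apply/idP/idP; lra.
Qed.

Definition local_piece G :=
  [/\ polyconvex G, saturated G & exists z, G `<=` lattice_cube z].

Lemma local_piece_lattice_cube z : local_piece (lattice_cube z).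
Proof.
split; [|exact: saturated_lattice_cube|by exists z].
exact: (convex_body_polyconvex (convex_body_lattice_cube z)).
Qed.

Lemma local_pieceI G X : local_piece G -> polyconvex X -> saturated X ->
  local_piece (G `&` X).
Proof.
move=> [pG sG [z Gz]] pX sX; split; [exact: polyconvexI|exact: saturatedI|].
by exists z => x [/Gz].
Qed.

Variables (V : 'I_d.+1 -> set 'rV[R]_d -> R) (k : 'I_d.+1).
Hypothesis hV : additive_intrinsic_volumes V.

Definition cell_bound : R := \sum_S `|V k (cell_union S)|.

(* Up to a lattice translation there are only finitely many local pieces. *)
Lemma local_piece_bound G : local_piece G -> `|V k G| <= cell_bound.
Proof.
move=> [pG sG [z Gz]].
have := additive_intrinsic_volumes_homothety hV k (nat_row z) ltr01 pG.
rewrite expr1n invr1 mul1r => <-.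
(* The signatures met by the translate of [G]; by saturation the translate contains every cell it
   meets. *)
pose S := [set s : {ffun 'I_d -> bool * bool} |
  `[< exists2 x, G (x + nat_row z) & s = cell_signature x >]]%SET.
have G01 x : G (x + nat_row z) -> lattice_cube [ffun=> 0%N] x.
  by move=> /Gz xz i; have := xz i; rewrite !mxE ffunE; lra.
rewrite (_ : mkset _ = cell_union S).
  by rewrite /cell_bound (bigD1 S)//= lerDl sumr_ge0.
apply/seteqP; split=> x /=; rewrite scale1r.
  move=> Gx; split; first exact: G01.
  by rewrite inE; apply/asboolP; exists x.
move=> [x01]; rewrite inE => /asboolP[y Gy xy].
by apply: (sG _ _ _ Gy); apply: same_cell_signature; [exact: G01| |].
Qed.

(** Each new piece contributes its own value and that of its intersection with the union of the
    others, again a local piece; hence the factor 2. *)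
Lemma local_pieces_bound (I : eqType) (s : seq I) (G : I -> set 'rV[R]_d) :
  (forall i, i \in s -> local_piece (G i)) ->
  `|V k (\big[setU/set0]_(i <- s) G i)| <= 2 * cell_bound * (size s)%:R.
Proof.
elim: s => [|i s IHs] sG; first by rewrite big_nil (aiv_set0 hV) normr0 mulr0.
have {}IHs : `|V k (\big[setU/set0]_(i <- s) G i)| <= 2 * cell_bound * (size s)%:R.
  by apply: IHs => j js; apply: sG; rewrite inE js orbT.
have pX : polyconvex (\big[setU/set0]_(i <- s) G i).
  by apply: polyconvex_bigsetU => j js _; have [] := sG j; rewrite ?inE ?js ?orbT.
have sX : saturated (\big[setU/set0]_(i <- s) G i).
  rewrite big_seq; apply: saturated_bigsetU => j js.
  by have [] := sG j; rewrite ?inE ?js ?orbT.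
have Gi := sG i (mem_head _ _).
rewrite big_cons (additive_intrinsic_volumesU hV)//; last by case: Gi.
have b1 := local_piece_bound Gi.
have b2 := local_piece_bound (local_pieceI Gi pX sX).
rewrite /= -[(size s).+1%:R]natr1 mulrDr mulr1.
apply: (le_trans (ler_normB _ _)).
apply: (@le_trans _ _ (cell_bound + 2 * cell_bound * (size s)%:R + cell_bound)).
  by apply: lerD => //; apply: (le_trans (ler_normD _ _)); exact: lerD.
by rewrite le_eqVlt; apply/orP; left; apply/eqP; ring.
Qed.

(** When the sets are added one at a time, the only defect is the value on the intersection of the
    new set with the union of the others. The bound [e i] is asked for all unions avoiding [i] so
    that it passes to sublists. *)
Lemma nearly_additive (I : eqType) (s : seq I) (A : I -> set 'rV[R]_d) (e : I -> R) :
  uniq s -> (forall i, i \in s -> polyconvex (A i)) ->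
  (forall i (t : seq I), i \in s -> i \notin t -> {subset t <= s} ->
     `|V k (A i `&` \big[setU/set0]_(j <- t) A j)| <= e i) ->
  `|V k (\big[setU/set0]_(i <- s) A i) - \sum_(i <- s) V k (A i)| <= \sum_(i <- s) e i.
Proof.
elim: s => [|i s IHs]; first by rewrite !big_nil (aiv_set0 hV) subr0 normr0.
move=> /= /andP[si us] pA Ae; rewrite !big_cons.
have pA' j : j \in s -> polyconvex (A j).
  by move=> js; apply: pA; rewrite inE js orbT.
rewrite (additive_intrinsic_volumesU hV); last 2 first.
- by apply: pA; exact: mem_head.
- by apply: polyconvex_bigsetU => j js _; exact: pA'.
have h1 : `|V k (\big[setU/set0]_(i <- s) A i) - \sum_(i <- s) V k (A i)| <=
    \sum_(i <- s) e i.
  apply: IHs => // j t js jt ts; apply: Ae => //; first by rewrite inE js orbT.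
  by move=> l /ts ls; rewrite inE ls orbT.
have h2 : `|V k (A i `&` \big[setU/set0]_(j <- s) A j)| <= e i.
  by apply: Ae => //; [exact: mem_head|move=> l ls; rewrite inE ls orbT].
rewrite [X in `|X|](_ : _ = V k (\big[setU/set0]_(i <- s) A i) -
  \sum_(i <- s) V k (A i) - V k (A i `&` \big[setU/set0]_(j <- s) A j)); last by ring.
by rewrite [leRHS]addrC; apply: le_trans (ler_normB _ _) _; exact: lerD.
Qed.

End lattice_cells.

(** * Trees of retained cubes *)

(* [t : tree A n] records, for every word of length at most [n] over [A], one
   bit: [(t a).1] is the bit of the one-letter word [a]. *)
Fixpoint tree (A : finType) (n : nat) : finType :=
  if n is m.+1 then {ffun A -> bool * tree A m} else unit.

Fixpoint branch_count (A : finType) (L : {set A}) (n : nat) : tree A n -> nat :=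
  if n is m.+1 then fun t : tree A m.+1 =>
    (\sum_(a in L) (t a).1 * branch_count L (t a).2)%N
  else fun=> 1%N.

Section trees_of_cubes.
Variables (d M : nat).

(** The first letter of a word is the leading base-[M] digit of each coordinate of the corner. *)
Definition corner_shift n (j : letter d M) (c : {ffun 'I_d -> nat}) :
  {ffun 'I_d -> nat} := [ffun i => M ^ n * j i + c i]%N.

(* Lower corners, in units of [M^-n], of the retained cubes of level [n]. *)
Fixpoint corners (n : nat) : tree (letter d M) n -> seq {ffun 'I_d -> nat} :=
  if n is m.+1 then fun t : tree (letter d M) m.+1 =>
    flatten [seq map (corner_shift m j) (corners (t j).2) |
      j <- enum {: letter d M} & (t j).1]
  else fun=> [:: [ffun=> 0%N]].

Definition on_boundary n (c : {ffun 'I_d -> nat}) :=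
  [exists i, (c i == 0%N) || ((c i).+1 == M ^ n)%N].

Lemma corners_bound n (t : tree (letter d M) n) c i :
  c \in corners t -> (c i < M ^ n)%N.
Proof.
elim: n t c => [|n IHn] t c /=; first by rewrite inE => /eqP ->; rewrite ffunE.
move=> /flattenP[_ /mapP[j _ ->] /mapP[c' /IHn c'M ->]]; rewrite ffunE.
rewrite expnSr; apply: (@leq_trans (M ^ n * (j i).+1)); last by rewrite leq_mul2l ltn_ord orbT.
by rewrite mulnSr ltn_add2l.
Qed.

Definition face_corner n (i : 'I_d) (v : bool) (c : {ffun 'I_d -> nat}) :=
  c i == if v then (M ^ n).-1 else 0%N.

Definition face_letters (i : 'I_d) (v : bool) : {set letter d M} :=
  [set j : letter d M | val (j i) == if v then M.-1 else 0%N]%SET.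

(** A corner lies on a given face exactly when all base-[M] digits of that coordinate are extreme,
    so the cubes along a face form a branching process over the letters of that face. *)
Lemma count_corners_face n (t : tree (letter d M) n) (i : 'I_d) (v : bool) :
  count (face_corner n i v) (corners t) = branch_count (face_letters i v) t.
Proof.
(* A two-digit number is extreme if and only if both digits are. *)
have digits m j c w : (j < M)%N -> (c < m)%N ->
    (m * j + c == if w then (m * M).-1 else 0)%N =
    ((j == if w then M.-1 else 0) && (c == if w then m.-1 else 0))%N.
  move=> jM cm; case: w; last by rewrite addn_eq0 muln_eq0; lia.
  apply/eqP/andP => [E|[/eqP -> /eqP ->]]; last by nia.
  have jE : j = M.-1 by nia.
  by split; apply/eqP => //; nia.
elim: n t => [|n IHn] t /=; first by rewrite /face_corner ffunE; case: v.
rewrite count_flatten sumnE !big_map big_filter.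
rewrite big_enum_cond/= big_mkcond/= [RHS]big_mkcond/=.
apply: eq_bigr => j _; rewrite inE count_map.
rewrite (@eq_in_count _ _ (fun c => (val (j i) == if v then M.-1 else 0%N) &&
    face_corner n i v c)); last first.
  move=> c cj; rewrite /= /face_corner /corner_shift ffunE expnSr.
  by rewrite digits// (corners_bound i cj).
case: (t j).1; last by rewrite mul0n if_same.
by case: (val (j i) == _) => /=; [rewrite mul1n -IHn|exact: count_pred0].
Qed.

Lemma count_boundary n (t : tree (letter d M) n) :
  (count (on_boundary n) (corners t) <=
   \sum_(i < d) \sum_(v : bool) branch_count (face_letters i v) t)%N.
Proof.
under eq_bigr do under eq_bigr do rewrite -count_corners_face.
elim: (corners t) => [|c s IHs] //=.
under eq_bigr do rewrite big_split; rewrite big_split/= leq_add//.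
case: (boolP (on_boundary n c)) => // /existsP[i ci]; rewrite (bigD1 i)//= addn_gt0; apply/orP; left.
rewrite big_bool /face_corner addn_gt0 !lt0b.
by case/orP: ci => [->|/eqP <-]; rewrite ?orbT//= eqxx.
Qed.

End trees_of_cubes.

Section additive_functional_on_trees.
Variables (R : realType) (d M : nat) (V : 'I_d.+1 -> set 'rV[R]_d -> R) (k : 'I_d.+1).
Hypothesis hV : additive_intrinsic_volumes V.

Definition cubes_set (s : seq {ffun 'I_d -> nat}) : set 'rV[R]_d :=
  \big[setU/set0]_(c <- s) lattice_cube c.

Lemma cubes_setP s x : cubes_set s x <-> exists2 c, c \in s & lattice_cube c x.
Proof.
by rewrite /cubes_set -bigcup_seq; split=> -[c cs cx]; exists c.
Qed.

Lemma polyconvex_cubes_set s : polyconvex (cubes_set s).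
Proof.
apply: polyconvex_bigsetU => c _ _.
exact: (convex_body_polyconvex (convex_body_lattice_cube _ c)).
Qed.

Lemma saturated_cubes_set s : saturated (cubes_set s).
Proof. by apply: saturated_bigsetU => c _; exact: saturated_lattice_cube. Qed.

Lemma cubes_set_shift n (j : letter d M) s :
  cubes_set (map (corner_shift n j) s) =
  [set x : 'rV[R]_d | cubes_set s (1 *: x - nat_row R [ffun i => M ^ n * j i]%N)].
Proof.
apply/seteqP; split=> x; rewrite /= scale1r => /cubes_setP.
  move=> [_ /mapP[c cs ->] cx]; apply/cubes_setP; exists c => // i.
  by have := cx i; rewrite !mxE !ffunE natrD; lra.
move=> [c cs cx]; apply/cubes_setP; exists (corner_shift n j c); first exact: map_f.
by move=> i; have := cx i; rewrite !mxE !ffunE natrD; lra.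
Qed.

Lemma valuation_cubes_set_shift n (j : letter d M) s :
  V k (cubes_set (map (corner_shift n j) s)) = V k (cubes_set s).
Proof.
rewrite cubes_set_shift additive_intrinsic_volumes_homothety//.
  by rewrite expr1n invr1 mul1r.
exact: polyconvex_cubes_set.
Qed.

(** In a coordinate where [j] and [l] differ, the side of a cube off the boundary lies strictly
    inside the side of its block, while the two blocks share at most an endpoint. *)
Lemma corner_shift_disjoint n (j l : letter d M) (t u : tree (letter d M) n) c x :
  j != l -> c \in corners t -> ~~ on_boundary M n c ->
  lattice_cube (corner_shift n j c) x -> ~ cubes_set (map (corner_shift n l) (corners u)) x.
Proof.
move=> jl ct cb cx /cubes_setP[_ /mapP[c' c'u ->] c'x].
have /existsP[i ji] : [exists i, j i != l i].
  rewrite -negb_forall; apply: contra jl => /forallP jl.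
  by apply/eqP/ffunP => i; exact/eqP.
move: cb => /existsPn/(_ i); rewrite negb_or => /andP[c0 cM].
have := c'x i; have := cx i; rewrite !ffunE => /andP[h1 h2] /andP[h3 h4].
have := corners_bound i ct; have := corners_bound i c'u => c'M ccM.
have : (M ^ n * j i + c i <= (M ^ n * l i + c' i).+1)%N.
  by rewrite -(ler_nat R) -natr1; lra.
have : (M ^ n * l i + c' i <= (M ^ n * j i + c i).+1)%N.
  by rewrite -(ler_nat R) -natr1; lra.
move=> clc ccl; have : (M ^ n * (j i).+1 <= M ^ n * l i)%N \/ (M ^ n * (l i).+1 <= M ^ n * j i)%N.
  move: ji; rewrite -val_eqE /= neq_ltn => /orP[il|il]; [left|right];
    by rewrite leq_mul2l il orbT.
rewrite !mulnS; move: c0 cM c'M ccM clc ccl.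
move: (M ^ n * j i)%N (M ^ n * l i)%N (M ^ n)%N (c i) (c' i) => a b q r r'.
by clear; lia.
Qed.

(** The block of one letter meets the other blocks only in its boundary cubes. The intersections in
    [nearly_additive] thus split into one local piece for each boundary cube. *)
Lemma valuation_tree_recursion n (t : tree (letter d M) n.+1) :
  `|V k (cubes_set (corners t)) - \sum_(j | (t j).1) V k (cubes_set (corners (t j).2))|
  <= \sum_(j | (t j).1)
       2 * cell_bound V k * (count (on_boundary M n) (corners (t j).2))%:R.
Proof.
pose A (j : letter d M) := cubes_set (map (corner_shift n j) (corners (t j).2)).
pose s := [seq j <- enum {: letter d M} | (t j).1].
have -> : cubes_set (corners t) = \big[setU/set0]_(j <- s) A j.
  by rewrite /cubes_set /= big_flatten/= big_map.
have sumE (F : letter d M -> R) : \sum_(j | (t j).1) F j = \sum_(j <- s) F j.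
  by rewrite /s big_filter big_enum_cond.
rewrite !sumE.
have -> : \sum_(j <- s) V k (cubes_set (corners (t j).2)) = \sum_(j <- s) V k (A j).
  by apply: eq_bigr => j _; rewrite valuation_cubes_set_shift.
apply: (@nearly_additive _ _ _ k hV (letter d M) s A (fun j =>
  2 * cell_bound V k * (count (on_boundary M n) (corners (t j).2))%:R))
  => [|j _|j r js jr rs].
- by rewrite filter_uniq// enum_uniq.
- exact: polyconvex_cubes_set.
set X := \big[setU/set0]_(l <- r) A l.
have pX : polyconvex X by apply: polyconvex_bigsetU => l _ _; exact: polyconvex_cubes_set.
have sX : saturated X by apply: saturated_bigsetU => l _; exact: saturated_cubes_set.
rewrite -size_filter.
rewrite (_ : A j `&` X = \big[setU/set0]_(c <- [seq c <- corners (t j).2 | on_boundary M n c])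
    (lattice_cube (corner_shift n j c) `&` X)).
  apply: local_pieces_bound => // c _.
  by apply: local_pieceI => //; exact: local_piece_lattice_cube.
rewrite -bigcup_seq; apply/seteqP; split=> x.
  move=> [/cubes_setP[_ /mapP[c ct ->] cx] Xx]; exists c; last by [].
  rewrite /= mem_filter ct andbT; apply: contraT => cb; exfalso.
  move: Xx; rewrite /X -bigcup_seq => -[l /= lr].
  by apply: (corner_shift_disjoint _ ct cb cx); apply: contraNneq jr => ->.
move=> [c /=]; rewrite mem_filter => /andP[_ ct] [cx Xx]; split=> //.
by apply/cubes_setP; exists (corner_shift n j c) => //; exact: map_f.
Qed.

End additive_functional_on_trees.

(** * From configurations of bits to trees and their cubes *)

Section tree_of_configuration.
Variables (A : finType) (y : seq A -> bool).

Fixpoint tree_at (n : nat) (r : seq A) : tree A n :=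
  if n is m.+1 then [ffun a => (y (rcons r a), tree_at m (rcons r a))] else tt.

(** The word [r] has already been read and its bits are not tested again; the empty [r] gives
    [retained]. *)
Definition retained_from (r s : seq A) :=
  all (fun m => y (r ++ take m s)) (iota 1 (size s)).

Lemma retained_from_cons r a s :
  retained_from r (a :: s) = y (rcons r a) && retained_from (rcons r a) s.
Proof.
rewrite /retained_from /= take0 cats1 (iotaDl 1 1) all_map; congr andb.
by apply: eq_all => m /=; rewrite cat_rcons.
Qed.

Lemma card_retained_from n r :
  #|[pred s : n.-tuple A | retained_from r s]| = branch_count [set: A]%SET (tree_at n r).
Proof.
elim: n r => [|n IHn] r /=.
  rewrite (eq_card (B := predT)) ?card_tuple// => s.
  by rewrite !inE [s]tuple0.
rewrite -sum1_card big_mkcond/=.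
rewrite (reindex (fun p : A * n.-tuple A => [tuple of p.1 :: p.2])); last first.
  exists (fun s : n.+1.-tuple A => (thead s, [tuple of behead s])).
    by move=> [a s] _; congr (_, _); exact: val_inj.
  by move=> s _; rewrite [RHS]tuple_eta.
rewrite -(pair_bigA _ (fun a (s : n.-tuple A) =>
  if retained_from r (a :: s) then 1%N else 0%N))/=.
apply: eq_big => [a|a _]; first by rewrite inE.
rewrite ffunE /= -IHn -sum1_card [in RHS]big_mkcond/= big_distrr/=.
by apply: eq_bigr => s _; rewrite retained_from_cons; case: (y _); rewrite /= ?mul1n.
Qed.

End tree_of_configuration.

Section geometry_of_configuration.
Variables (R : realType) (d M : nat) (y : seq (letter d M) -> bool).
Hypothesis M0 : (0 < M)%N.

(** If [x = phi j v] then [M^(n+1) x = M^n v + M^n j]: in the magnified picture the first letter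
    acts as [corner_shift], which carries the induction. *)
Lemma retained_cubesP n (r : seq (letter d M)) (x : 'rV[R]_d) :
  (exists s, [/\ size s = n, retained_from y r s & basic_cube s x]) <->
  cubes_set (corners (tree_at y n r)) (M%:R ^+ n *: x).
Proof.
have Mn0 : M%:R != 0 :> R by rewrite pnatr_eq0 -lt0n.
elim: n r x => [|n IHn] r x.
  rewrite scale1r; split.
    move=> [s [/size0nil-> _ x01]]; apply/cubes_setP; exists [ffun=> 0%N].
      by rewrite inE.
    by move=> i; rewrite ffunE add0r; exact: x01.
  move=> /cubes_setP[c]; rewrite inE => /eqP -> cx; exists [::]; split=> // i.
  by have := cx i; rewrite ffunE add0r.
have shift (j : letter d M) u v : u = (phi j v : 'rV[R]_d) <->
    forall i, M%:R * u ord0 i = v ord0 i + (j i)%:R.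
  split=> [-> i|uv]; first by rewrite mxE mulrC divfK.
  by apply/rowP => i; rewrite mxE -uv mulrAC divff// mul1r.
split.
  move=> [[|j s] [// [sn] + [v sv vx]]]; rewrite retained_from_cons => /andP[yj rs].
  have /(shift j _ v) xv := esym vx.
  have /IHn/cubes_setP[c ct cv] : exists s, [/\ size s = n, retained_from y (rcons r j) s & basic_cube s v].
    by exists s.
  apply/cubes_setP; exists (corner_shift n j c).
    apply/flattenP; exists (map (corner_shift n j) (corners (tree_at y n (rcons r j)))).
      by apply/mapP; exists j; [rewrite mem_filter mem_enum ffunE yj|rewrite ffunE].
    exact: map_f.
  move=> i; have := cv i; rewrite !mxE ffunE natrD natrM natrX exprSr -mulrA xv.
  lra.
move=> /cubes_setP[_ /flattenP[_ /mapP[j +->] /mapP[c ct ->]] cx].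
rewrite mem_filter ffunE/= => /andP[yj _].
pose v : 'rV[R]_d := \row_i (M%:R * x ord0 i - (j i)%:R).
have [s [sn rs sv]] : exists s, [/\ size s = n, retained_from y (rcons r j) s & basic_cube s v].
  apply/IHn/cubes_setP; exists c; first by move: ct; rewrite ffunE.
  move=> i; have := cx i; rewrite !mxE ffunE natrD natrM natrX exprSr -mulrA mulrBr.
  lra.
exists (j :: s); split; [by rewrite /= sn|by rewrite retained_from_cons yj|].
by exists v => //; apply/esym/(shift j) => i; rewrite mxE subrK.
Qed.

End geometry_of_configuration.

Section percolation_tree.
Context (disp : measure_display) (T : measurableType disp) (R : realType).
Context (P : probability T R) (d M : nat).
Context (Y : seq (letter d M) -> {RV P >-> bool}).
Hypothesis M0 : (0 < M)%N.

Definition percolation_tree n w := tree_at (fun s => Y s w) n [::].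

(** The summand [+ 0] gives the set the shape of a homothetic preimage, ready for the scaling of
    valuations. *)
Lemma F_stepE n w : F_step Y n w =
  [set x | cubes_set (corners (percolation_tree n w)) (M%:R ^+ n *: x + 0)].
Proof.
apply/seteqP; split=> x; rewrite /= addr0.
  by move=> [s rs sx]; apply/retained_cubesP => //; exists s; split=> //; exact: size_tuple.
move=> /retained_cubesP-/(_ M0)[s [sn rs sx]].
by exists (tcast sn (in_tuple s)); rewrite /= ?val_tcast.
Qed.

Lemma N_retainedE n w :
  N_retained Y n w = (branch_count [set: letter d M]%SET (percolation_tree n w))%:R.
Proof. by rewrite -card_retained_from. Qed.

Lemma valuation_F_step (V : 'I_d.+1 -> set 'rV[R]_d -> R) k n w :
  additive_intrinsic_volumes V ->
  V k (F_step Y n w) =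
  (M%:R ^+ n) ^- k * V k (cubes_set (corners (percolation_tree n w))).
Proof.
move=> hV; rewrite F_stepE additive_intrinsic_volumes_homothety//.
  by rewrite exprn_gt0 ?ltr0n.
exact: polyconvex_cubes_set.
Qed.

End percolation_tree.

(** * Second moments on random trees *)

Section tree_expectation.
Variables (R : realType) (A : finType) (p : R).
Hypothesis p01 : 0 <= p <= 1.

Definition bit_weight (b : bool) : R := if b then p else 1 - p.

(** The probability of [t] when its bits are independent Bernoulli variables with parameter [p]. *)
Fixpoint tree_weight n : tree A n -> R :=
  if n is m.+1 then fun t : tree A m.+1 =>
    \prod_a (bit_weight (t a).1 * tree_weight (t a).2)
  else fun=> 1.

Definition tree_mean n (g : tree A n -> R) : R := \sum_t tree_weight t * g t.

Lemma bit_weight_ge0 b : 0 <= bit_weight b.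
Proof. by case/andP: p01 => p0 p1; case: b; rewrite //= subr_ge0. Qed.

Lemma tree_weight_ge0 n (t : tree A n) : 0 <= tree_weight t.
Proof.
elim: n t => [|n IHn] t //=.
by apply: prodr_ge0 => a _; rewrite mulr_ge0// bit_weight_ge0.
Qed.

Lemma eq_tree_mean n (g h : tree A n -> R) : g =1 h -> tree_mean g = tree_mean h.
Proof. by move=> gh; apply: eq_bigr => t _; rewrite gh. Qed.

Lemma le_tree_mean n (g h : tree A n -> R) :
  (forall t, g t <= h t) -> tree_mean g <= tree_mean h.
Proof. by move=> gh; apply: ler_sum => t _; rewrite ler_wpM2l// tree_weight_ge0. Qed.

Lemma tree_mean_ge0 n (g : tree A n -> R) : (forall t, 0 <= g t) -> 0 <= tree_mean g.
Proof. by move=> g0; apply: sumr_ge0 => t _; rewrite mulr_ge0// tree_weight_ge0. Qed.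

Lemma tree_meanD n (g h : tree A n -> R) :
  tree_mean (fun t => g t + h t) = tree_mean g + tree_mean h.
Proof. by rewrite -big_split; apply: eq_bigr => t _; rewrite mulrDr. Qed.

Lemma tree_meanZ n c (g : tree A n -> R) : tree_mean (fun t => c * g t) = c * tree_mean g.
Proof. by rewrite mulr_sumr; apply: eq_bigr => t _; rewrite mulrCA. Qed.

Lemma tree_mean_sum n (I : Type) (s : seq I) (P : pred I) (g : I -> tree A n -> R) :
  tree_mean (fun t => \sum_(i <- s | P i) g i t) = \sum_(i <- s | P i) tree_mean (g i).
Proof.
by rewrite exchange_big/=; apply: eq_bigr => t _; rewrite mulr_sumr.
Qed.

Definition branch_mean n (h : bool * tree A n -> R) : R :=
  \sum_x bit_weight x.1 * tree_weight x.2 * h x.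

(** Independence of the branches, which for finite sums is distributivity of the product over the
    sum. *)
Lemma tree_mean_prod n (h : A -> bool * tree A n -> R) :
  tree_mean (fun t : tree A n.+1 => \prod_a h a (t a)) = \prod_a branch_mean (h a).
Proof.
rewrite bigA_distr_bigA/=; apply: eq_bigr => t _.
by rewrite -big_split.
Qed.

Lemma branch_mean_bit n (g : tree A n -> R) :
  branch_mean (fun x => x.1%:R * g x.2) = p * tree_mean g.
Proof.
rewrite /branch_mean -(pair_bigA _ (fun b t =>
  bit_weight b * tree_weight t * (b%:R * g t)))/= big_bool/=.
rewrite [X in _ + X]big1 ?addr0 => [|t _]; last by rewrite mul0r mulr0.
by rewrite mulr_sumr; apply: eq_bigr => t _; rewrite mul1r mulrA.
Qed.

Lemma tree_mean1 n : tree_mean (fun _ : tree A n => 1) = 1.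
Proof.
elim: n => [|n IHn].
  by rewrite /tree_mean (big_pred1 tt) ?mulr1// => -[].
transitivity (tree_mean (fun t : tree A n.+1 => \prod_(a : A) 1)).
  by apply: eq_tree_mean => t; rewrite big1.
rewrite (tree_mean_prod (fun _ _ => 1)) big1// => a _.
rewrite /branch_mean -(pair_bigA _ (fun b (t : tree A n) =>
  bit_weight b * tree_weight t * 1))/= big_bool/=.
transitivity (p * tree_mean (fun _ : tree A n => 1) +
   (1 - p) * tree_mean (fun _ : tree A n => 1)); last by rewrite IHn; ring.
by rewrite /tree_mean !mulr_sumr; congr (_ + _); apply: eq_bigr => t _; rewrite mulrA.
Qed.

Lemma tree_mean_cst n c : tree_mean (fun _ : tree A n => c) = c.
Proof.
transitivity (tree_mean (fun _ : tree A n => c * 1)).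
  by apply: eq_tree_mean => t; rewrite mulr1.
by rewrite tree_meanZ tree_mean1 mulr1.
Qed.

Lemma branch_mean1 n : branch_mean (fun _ : bool * tree A n => 1) = 1.
Proof.
rewrite /branch_mean -(pair_bigA _ (fun b (t : tree A n) =>
  bit_weight b * tree_weight t * 1))/= big_bool/=.
transitivity (p * tree_mean (fun _ : tree A n => 1) +
   (1 - p) * tree_mean (fun _ : tree A n => 1)); last by rewrite tree_mean1; ring.
by rewrite /tree_mean !mulr_sumr; congr (_ + _); apply: eq_bigr => t _; rewrite mulrA.
Qed.

Lemma tree_mean_branch n (h : bool * tree A n -> R) a :
  tree_mean (fun t : tree A n.+1 => h (t a)) = branch_mean h.
Proof.
(* Factors 1 at the other letters bring the mean into product form. *)
transitivity (tree_mean (fun t : tree A n.+1 => \prod_b (if b == a then h (t b) else 1))).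
  by apply: eq_tree_mean => t; rewrite -big_mkcond big_pred1_eq.
rewrite (tree_mean_prod (fun b x => if b == a then h x else 1)).
rewrite (bigD1 a)//= eqxx big1 ?mulr1// => b /negbTE ->.
exact: branch_mean1.
Qed.

Lemma tree_mean_branch2 n (h : bool * tree A n -> R) a b : a != b ->
  tree_mean (fun t : tree A n.+1 => h (t a) * h (t b)) = branch_mean h ^+ 2.
Proof.
move=> ab.
transitivity (tree_mean (fun t : tree A n.+1 =>
    \prod_c (if (c == a) || (c == b) then h (t c) else 1))).
  apply: eq_tree_mean => t; rewrite (bigD1 a)//= eqxx (bigD1 b)/= ?(eq_sym b)// eqxx orbT.
  by rewrite big1 ?mulr1// => c /andP[/negbTE -> /negbTE ->].
rewrite (tree_mean_prod (fun c x => if (c == a) || (c == b) then h x else 1)).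
rewrite (bigD1 a)//= eqxx (bigD1 b)/= ?(eq_sym b)// eqxx orbT expr2.
rewrite big1 ?mulr1// => c /andP[/negbTE -> /negbTE ->].
exact: branch_mean1.
Qed.

(** The difference of the two sides is the variance of [g]. *)
Lemma sqr_tree_mean_le n (g : tree A n -> R) :
  tree_mean g ^+ 2 <= tree_mean (fun t => g t ^+ 2).
Proof.
set m := tree_mean g; rewrite -subr_ge0.
have -> : tree_mean (fun t => g t ^+ 2) - m ^+ 2 = tree_mean (fun t => (g t - m) ^+ 2).
  transitivity (tree_mean (fun t => g t ^+ 2 + (- 2 * m * g t + m ^+ 2))).
    by rewrite tree_meanD tree_meanD tree_meanZ tree_mean_cst -/m; ring.
  by apply: eq_tree_mean => t; ring.
by apply: tree_mean_ge0 => t; exact: sqr_ge0.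
Qed.

(** The bit switches off discarded letters; [L] will be the whole alphabet or the letters of one
    face. *)
Definition branch_sum (L : {set A}) n (g : tree A n -> R) (t : tree A n.+1) : R :=
  \sum_(a in L) (t a).1%:R * g (t a).2.

Lemma tree_mean_branch_sum (L : {set A}) n (g : tree A n -> R) :
  tree_mean (branch_sum L g) = #|L|%:R * p * tree_mean g.
Proof.
rewrite tree_mean_sum -mulrA -branch_mean_bit mulr_natl -sumr_const.
by apply: eq_bigr => a _; rewrite -(tree_mean_branch _ a).
Qed.

(** Diagonal terms give the second moment of [g]; the others factor by independence. Adding the
    missing diagonal squares of means completes the last square. *)
Lemma tree_mean_branch_sum_sqr (L : {set A}) n (g : tree A n -> R) :
  tree_mean (fun t => branch_sum L g t ^+ 2) <=
  #|L|%:R * p * tree_mean (fun t => g t ^+ 2) + (#|L|%:R * p * tree_mean g) ^+ 2.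
Proof.
pose h (x : bool * tree A n) : R := x.1%:R * g x.2.
have -> : tree_mean (fun t => branch_sum L g t ^+ 2) =
    \sum_(a in L) \sum_(b in L) tree_mean (fun t : tree A n.+1 => h (t a) * h (t b)).
  under eq_bigr do rewrite -tree_mean_sum.
  rewrite -tree_mean_sum; apply: eq_tree_mean => t.
  by rewrite expr2 /branch_sum mulr_suml; apply: eq_bigr => a _; rewrite mulr_sumr.
have hh a : tree_mean (fun t : tree A n.+1 => h (t a) * h (t a)) =
    p * tree_mean (fun t => g t ^+ 2).
  rewrite (tree_mean_branch (fun x => h x * h x)) -branch_mean_bit.
  by apply: eq_bigr => -[[] t] _; rewrite /h /= ?mul1r ?mul0r.
have hE : branch_mean h = p * tree_mean g by exact: branch_mean_bit.
apply: (@le_trans _ _ (\sum_(a in L) (p * tree_mean (fun t => g t ^+ 2) +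
    \sum_(b in L) branch_mean h ^+ 2))).
  apply: ler_sum => a aL; rewrite (bigD1 a)//= hh lerD2l.
  rewrite [leRHS](bigD1 a)//=; apply: ler_wpDl; first exact: sqr_ge0.
  by apply: ler_sum => b /andP[_ ba]; rewrite tree_mean_branch2// eq_sym.
rewrite !sumr_const hE -[leLHS]mulr_natl -[_ ^+ 2 *+ _]mulr_natl le_eqVlt; apply/orP; left; apply/eqP.
ring.
Qed.

End tree_expectation.

(** * Geometric decay *)

Section geometric_decay.
Variable R : realType.

Definition geom_decay (x : nat -> R) :=
  exists C rho, [/\ 0 <= C, 0 <= rho, rho < 1 & forall n, x n <= C * rho ^+ n].

Lemma geom_decay_le c (x y : nat -> R) : 0 <= c ->
  (forall n, y n <= c * x n) -> geom_decay x -> geom_decay y.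
Proof.
move=> c0 yx [C [rho [C0 r0 r1 xC]]]; exists (c * C), rho; split=> // [|n].
  exact: mulr_ge0.
by apply: le_trans (yx n) _; rewrite -mulrA ler_wpM2l.
Qed.

Lemma geom_decayX (q : R) : 0 <= q -> q < 1 -> geom_decay (fun n => q ^+ n).
Proof. by move=> q0 q1; exists 1, q; split=> // n; rewrite mul1r. Qed.

Lemma geom_decayD (x y : nat -> R) :
  geom_decay x -> geom_decay y -> geom_decay (fun n => x n + y n).
Proof.
move=> [C [r [C0 r0 r1 xC]]] [D [s [D0 s0 s1 yD]]].
exists (C + D), (Num.max r s); split=> [| | |n].
- exact: addr_ge0.
- by rewrite le_max r0.
- by rewrite gt_max r1.
rewrite mulrDl; apply: lerD.
  by apply: le_trans (xC n) _; rewrite ler_wpM2l// lerXn2r ?nnegrE ?le_max ?lexx ?r0.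
by apply: le_trans (yD n) _; rewrite ler_wpM2l// lerXn2r ?nnegrE ?le_max ?lexx ?s0 ?orbT.
Qed.

Lemma geom_decay_recursion a (x y : nat -> R) : 0 <= a -> a < 1 ->
  (forall n, x n.+1 <= a * x n + y n) -> geom_decay y -> geom_decay x.
Proof.
move=> a0 a1 xy [C [r [C0 r0 r1 yC]]].
(* A rate strictly between both given rates and 1, so that [s - a] is positive. *)
pose s := (1 + Num.max a r) / 2.
have ma : a <= Num.max a r by rewrite le_max lexx.
have mr : r <= Num.max a r by rewrite le_max lexx orbT.
have m1 : Num.max a r < 1 by rewrite gt_max a1.
have sa : a < s by rewrite /s; lra.
have sr : r <= s by rewrite /s; lra.
have s1 : s < 1 by rewrite /s; lra.
have s0 : 0 <= s by exact: le_trans sr.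
(* [K] covers the initial value and satisfies [C <= K * (s - a)], which closes the induction. *)
pose K := Num.max `|x 0%N| (C / (s - a)).
have K0 : 0 <= K by rewrite le_max normr_ge0.
exists K, s; split=> //; elim=> [|n IHn].
  by rewrite expr0 mulr1 /K le_max ler_norm.
apply: le_trans (xy n) _.
have yn : y n <= C * s ^+ n.
  by apply: le_trans (yC n) _; rewrite ler_wpM2l// lerXn2r ?nnegrE.
have CK : C <= K * (s - a) by rewrite -ler_pdivrMr ?subr_gt0// le_max lexx orbT.
have sn : 0 <= s ^+ n by rewrite exprn_ge0.
have h1 : a * x n <= a * (K * s ^+ n) by rewrite ler_wpM2l.
have h2 : C * s ^+ n <= K * (s - a) * s ^+ n by rewrite ler_wpM2r.
rewrite exprS; lra.
Qed.

(* Through [abs_le_geom], a decay of second moments yields one of first moments. *)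
Lemma geom_decay_sqr (x : nat -> R) : (forall n, 0 <= x n) -> geom_decay x ->
  exists s : R, [/\ 0 < s, s < 1 & geom_decay (fun n => s ^+ n + s ^- n * x n)].
Proof.
move=> x0 [C [r [C0 r0 r1 xC]]]; exists ((1 + r) / 2).
set s := (1 + r) / 2.
have s0 : 0 < s by rewrite /s; lra.
have s1 : s < 1 by rewrite /s; lra.
have rs : r < s by rewrite /s; lra.
split=> //; apply: geom_decayD; first by apply: geom_decayX => //; exact: ltW.
exists C, (r / s); split=> // [| |n].
- by rewrite divr_ge0// ltW.
- by rewrite ltr_pdivrMr// mul1r.
by rewrite [(r / s) ^+ n]expr_div_n [leLHS]mulrC mulrA ler_wpM2r// invr_ge0 exprn_ge0// ltW.
Qed.

(** After multiplication by [a = s^n], with [b = |x|], this is [a b <= a^2 + b^2]. *)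
Lemma abs_le_geom (s x : R) n : 0 < s -> `|x| <= s ^+ n + s ^- n * x ^+ 2.
Proof.
move=> s0; have sn : 0 < s ^+ n by rewrite exprn_gt0.
rewrite -(ler_pM2l sn) mulrDr mulrA divff ?gt_eqF// mul1r -[x ^+ 2]real_normK ?num_real//.
move: (normr_ge0 x); move: (`|x|) (s ^+ n) sn => a b b0 a0; nra.
Qed.

Lemma cvg_series_increments (u : R^nat) :
  cvgn [series `|u n.+1 - u n|]_n -> cvgn u.
Proof.
move=> /normed_cvg; rewrite (_ : series _ = fun n => u n - u 0%N); last first.
  apply/funext; elim=> [|n IHn]; first by rewrite seriesEnat/= big_geq// subrr.
  by rewrite seriesSr IHn addrC addrA subrK.
move=> h; rewrite (_ : u = (fun n => u n - u 0%N) + cst (u 0%N)).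
  by apply: is_cvgD => //; exact: is_cvg_cst.
by apply/funext => n; rewrite fctE [cst _ n]/= subrK.
Qed.

Lemma geom_decay_series (x : nat -> R) : (forall n, 0 <= x n) -> geom_decay x ->
  cvgn (series x).
Proof.
move=> x0 [C [r [C0 r0 r1 xC]]].
apply: (series_le_cvg x0 _ xC) => [n|]; first by rewrite mulr_ge0// exprn_ge0.
by apply: is_cvg_geometric_series; rewrite ger0_norm.
Qed.

End geometric_decay.

(** * Second-moment recursions for branching functionals *)

Section branching_recursions.
Variables (R : realType) (A : finType) (p : R).
Hypothesis p01 : 0 <= p <= 1.
Let mu : R := #|A|%:R * p.
Hypothesis mu1 : 1 < mu.

Let mu0 : 0 < mu. Proof. exact: lt_trans mu1. Qed.
Let mun0 : mu != 0. Proof. by rewrite gt_eqF. Qed.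
Let imu0 : 0 < mu^-1. Proof. by rewrite invr_gt0. Qed.
Let imu1 : mu^-1 < 1. Proof. by rewrite invf_lt1. Qed.
Let A0 : #|A|%:R != 0 :> R.
Proof. by apply: contraTneq mu1 => A0; rewrite /mu A0 mul0r -leNgt. Qed.
Let p0 : p != 0.
Proof. by apply: contraTneq mu1 => p0; rewrite /mu p0 mulr0 -leNgt. Qed.

Local Notation E := (@tree_mean R A p _).

Definition branch_step (L : {set A}) n (g : tree A n -> R) (t : tree A n.+1) : R :=
  mu^-1 * branch_sum L g t.

Let ratio (L : {set A}) : R := #|L|%:R / #|A|%:R.

Let ratio_mu (L : {set A}) : mu^-1 * (#|L|%:R * p) = ratio L.
Proof. by rewrite /mu /ratio; field; rewrite A0 p0. Qed.

Let ratio_ge0 (L : {set A}) : 0 <= ratio L.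
Proof. by rewrite divr_ge0. Qed.

Let ratioT : ratio [set: A]%SET = 1.
Proof. by rewrite /ratio cardsT divff. Qed.

Lemma tree_mean_branch_step (L : {set A}) n (g : tree A n -> R) :
  E (branch_step L g) = ratio L * E g.
Proof. by rewrite tree_meanZ tree_mean_branch_sum mulrA ratio_mu. Qed.

(** Of the two factors [mu^-1] in the square, one is absorbed by the mean number of children; the
    other survives and contracts the second moment of centred functionals. *)
Lemma tree_mean_branch_step_sqr (L : {set A}) n (g : tree A n -> R) :
  E (fun t => branch_step L g t ^+ 2) <=
  ratio L * mu^-1 * E (fun t => g t ^+ 2) + (ratio L * E g) ^+ 2.
Proof.
rewrite (_ : E _ = mu^-1 ^+ 2 * E (fun t => branch_sum L g t ^+ 2)); last first.
  by rewrite -tree_meanZ; apply: eq_tree_mean => t; rewrite exprMn.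
apply: (@le_trans _ _ (mu^-1 ^+ 2 * (#|L|%:R * p * tree_mean p (fun t => g t ^+ 2) +
    (#|L|%:R * p * tree_mean p g) ^+ 2))).
  by rewrite ler_wpM2l ?sqr_ge0//; exact: tree_mean_branch_sum_sqr.
by rewrite -ratio_mu le_eqVlt; apply/orP; left; apply/eqP; ring.
Qed.

Definition scaled_count (L : {set A}) n (t : tree A n) : R :=
  mu ^- n * (branch_count L t)%:R.

Lemma scaled_countS (L : {set A}) n : @scaled_count L n.+1 =1 branch_step L (@scaled_count L n).
Proof.
move=> t; rewrite /scaled_count /branch_step /branch_sum /= exprS invfM -mulrA.
congr (_ * _); rewrite natr_sum mulr_sumr; apply: eq_bigr => a _.
by rewrite natrM mulrCA.
Qed.

Lemma tree_mean_scaled_count (L : {set A}) n : E (@scaled_count L n) = ratio L ^+ n.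
Proof.
elim: n => [|n IHn].
  rewrite (eq_tree_mean p (h := fun=> 1)) ?tree_mean1// => t.
  by rewrite /scaled_count expr0 invr1 mul1r.
rewrite (eq_tree_mean _ (@scaled_countS L n)) tree_mean_branch_step.
by rewrite IHn exprS.
Qed.

Lemma scaled_countT_L2_bounded : exists2 K, 0 <= K &
  forall n, E (fun t => @scaled_count [set: A]%SET n t ^+ 2) <= K.
Proof.
(* The fixed point of [x -> mu^-1 x + 1], the map that bounds the next second moment. *)
exists (1 - mu^-1)^-1 => [|n]; first by rewrite invr_ge0 subr_ge0 ltW.
have h : 0 < 1 - mu^-1 by rewrite subr_gt0.
elim: n => [|n IHn].
  rewrite (eq_tree_mean p (h := fun=> 1)) ?tree_mean1// => [|t].
    by rewrite invf_ge1// gerBl ltW.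
  by rewrite /scaled_count expr0 invr1 mul1r expr1n.
rewrite (eq_tree_mean p (h := fun t => branch_step [set: A]%SET (@scaled_count [set: A]%SET n) t ^+ 2)).
  apply: le_trans (tree_mean_branch_step_sqr _ _) _.
  rewrite ratioT !mul1r tree_mean_scaled_count ratioT !expr1n.
  have := ler_wpM2l (ltW imu0) IHn.
  rewrite [X in _ <= X -> _](_ : _ = (1 - mu^-1)^-1 - 1); first lra.
  by field; rewrite mun0 subr_eq0 gt_eqF.
by move=> t; rewrite scaled_countS.
Qed.

(** For a proper set of letters the mean is the [n]-th power of a ratio below 1, so the recursion
    has both a contracting factor and a decaying error. For the letters of a face, this makes
    boundary cubes negligible. *)
Lemma scaled_count_L2_decay (L : {set A}) : L != [set: A]%SET ->
  geom_decay (fun n => E (fun t => @scaled_count L n t ^+ 2)).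
Proof.
move=> LT.
have r1 : ratio L < 1.
  have LA : (#|L| < #|A|)%N.
    by rewrite -cardsT proper_card// finset.properEneq LT finset.subsetT.
  by rewrite /ratio ltr_pdivrMr ?mul1r ?ltr_nat// ltr0n (leq_ltn_trans _ LA).
have rmu1 : ratio L * mu^-1 < 1 by rewrite -[1]mulr1 ltr_pM// ltW.
apply: (@geom_decay_recursion _ (ratio L * mu^-1) _ (fun n => (ratio L ^+ 2) ^+ n)) => //.
- by rewrite mulr_ge0// ltW.
- move=> n; rewrite (eq_tree_mean p (h := fun t => branch_step L (@scaled_count L n) t ^+ 2)).
    apply: le_trans (tree_mean_branch_step_sqr _ _) _.
    rewrite tree_mean_scaled_count lerD2l -exprM mulnC exprM lerXn2r ?nnegrE ?mulr_ge0 ?exprn_ge0//.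
    by rewrite ler_piMl ?exprn_ge0// ltW.
  by move=> t; rewrite scaled_countS.
- apply: geom_decayX; first exact: sqr_ge0.
  by rewrite expr_lt1.
Qed.

Lemma L2_decayD (F G : forall n, tree A n -> R) :
  geom_decay (fun n => E (fun t => F n t ^+ 2)) ->
  geom_decay (fun n => E (fun t => G n t ^+ 2)) ->
  geom_decay (fun n => E (fun t => (F n t + G n t) ^+ 2)).
Proof.
move=> hF hG; apply: geom_decay_le (geom_decayD hF hG); first exact: (ler0n _ 2).
move=> n; rewrite -tree_meanD -tree_meanZ; apply: le_tree_mean => // t.
by have := sqr_ge0 (F n t - G n t); lra.
Qed.

(** Forgetting the last level makes two successive martingale values functions of one tree. *)
Fixpoint trunc n : tree A n.+1 -> tree A n :=
  if n is m.+1 then fun t : tree A m.+2 => [ffun a => ((t a).1, trunc (t a).2)]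
  else fun=> tt.

Definition W_increment n (t : tree A n.+1) : R :=
  @scaled_count [set: A]%SET n.+1 t - scaled_count [set: A]%SET (trunc t).

Lemma W_incrementS n : @W_increment n.+1 =1 branch_step [set: A]%SET (@W_increment n).
Proof.
move=> t; rewrite /W_increment !scaled_countS /branch_step -mulrBr; congr (_ * _).
rewrite /branch_sum -sumrB; apply: eq_bigr => a _.
by rewrite /= !ffunE /= -mulrBr.
Qed.

(** The increments have mean 0 and are exact branch steps of one another, so their second moments
    contract by [mu^-1]. *)
Lemma W_increment_L2_decay : geom_decay (fun n => E (fun t => @W_increment n t ^+ 2)).
Proof.
have mean0 n : E (@W_increment n) = 0.
  elim: n => [|n IHn]; last first.
    by rewrite (eq_tree_mean _ (@W_incrementS n)) tree_mean_branch_step IHn mulr0.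
  rewrite (eq_tree_mean p (h := fun t => @scaled_count [set: A]%SET 1 t + (-1))).
    by rewrite tree_meanD tree_mean_scaled_count ratioT expr1n tree_mean_cst subrr.
  by move=> t; rewrite /W_increment /scaled_count expr0 invr1 mulr1.
(* There is no error term here; [0 ^+ n] is a nonnegative sequence with geometric decay that stands
   in for it. *)
apply: (@geom_decay_recursion _ mu^-1 _ (fun n => 0 ^+ n)) => //.
- exact: ltW.
- move=> n; rewrite (eq_tree_mean p (h := fun t => branch_step [set: A]%SET (@W_increment n) t ^+ 2)).
    apply: le_trans (tree_mean_branch_step_sqr _ _) _.
    by rewrite mean0 ratioT mulr0 mul1r lerD2l [0 ^+ 2]expr0n exprn_ge0.
  by move=> t; rewrite W_incrementS.
- exact: geom_decayX.
Qed.

(** * Functionals that branch up to an error controlled by [B] *)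

Section nearly_branching_functional.
Variables (X B : forall n, tree A n -> R) (c : R).
Arguments X {n}.
Arguments B {n}.
Hypothesis XB : forall n (t : tree A n.+1),
  `|X t - branch_sum [set: A]%SET X t| <= c * branch_sum [set: A]%SET B t.
Hypothesis B_decay : geom_decay (fun n => E (fun t : tree A n => (mu ^- n * B t) ^+ 2)).

Let Z n (t : tree A n) : R := mu ^- n * X t.
Let z n : R := E (@Z n).
Let defect n (t : tree A n.+1) : R := Z t - branch_step [set: A]%SET (@Z n) t.

(** By [XB] the defect is at most [c] times a branch step of the scaled [B], whose second moment
    exceeds that of the scaled [B] by a factor of at most [mu^-1 + 1]. *)
Let defect_decay : geom_decay (fun n => E (fun t => @defect n t ^+ 2)).
Proof.
apply: (geom_decay_le (c := c ^+ 2 * (mu^-1 + 1))) B_decay.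
  by rewrite mulr_ge0 ?sqr_ge0// addr_ge0// ltW.
move=> n; pose b (t : tree A n) := mu ^- n * B t.
apply: (@le_trans _ _ (c ^+ 2 * E (fun t => branch_step [set: A]%SET b t ^+ 2))).
  rewrite -tree_meanZ; apply: le_tree_mean => // t; rewrite -exprMn.
  have le : `|defect t| <= c * branch_step [set: A]%SET b t.
    have scale (g : tree A n -> R) : mu ^- n.+1 * branch_sum [set: A]%SET g t =
        branch_step [set: A]%SET (fun u => mu ^- n * g u) t.
      rewrite /branch_step /branch_sum !mulr_sumr; apply: eq_bigr => a _.
      by rewrite exprS invfM; ring.
    rewrite /b -scale /defect -scale -mulrBr normrM gtr0_norm ?invr_gt0 ?exprn_gt0//.
    by rewrite mulrCA ler_wpM2l// invr_ge0 exprn_ge0// ltW.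
  rewrite -[leLHS]real_normK ?num_real// lerXn2r ?nnegrE//.
  exact: le_trans le.
rewrite -[leRHS]mulrA ler_wpM2l ?sqr_ge0//.
apply: le_trans (tree_mean_branch_step_sqr _ _) _.
rewrite ratioT !mul1r mulrDl lerD2l mul1r; exact: sqr_tree_mean_le.
Qed.

Let z_increment n : z n.+1 - z n = E (@defect n).
Proof.
rewrite /defect [RHS](eq_tree_mean p (h := fun t => Z t + -1 * branch_step [set: A]%SET (@Z n) t)).
  rewrite [RHS]tree_meanD; congr (_ + _).
  by rewrite [RHS]tree_meanZ tree_mean_branch_step ratioT mul1r mulN1r.
by move=> t; rewrite mulN1r.
Qed.

(** A branch step over all letters preserves means, so the increments of [z] are means of defects
    and hence absolutely summable. *)
Lemma cvg_nearly_branching_mean : cvgn z.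
Proof.
apply: cvg_series_increments.
have d0 n : 0 <= (z n.+1 - z n) ^+ 2 by exact: sqr_ge0.
have dd : geom_decay (fun n => (z n.+1 - z n) ^+ 2).
  apply: (geom_decay_le (c := 1)) defect_decay => // n.
  by rewrite mul1r z_increment; exact: sqr_tree_mean_le.
have [s [s0 s1 hs]] := geom_decay_sqr d0 dd.
have pos n : 0 <= s ^+ n + s ^- n * (z n.+1 - z n) ^+ 2.
  have sn : 0 <= s ^+ n by rewrite exprn_ge0// ltW.
  by apply: addr_ge0 => //; apply: mulr_ge0; [rewrite invr_ge0|exact: sqr_ge0].
apply: (series_le_cvg _ pos _ (geom_decay_series pos hs)) => n //=.
exact: abs_le_geom.
Qed.

(** Subtracting [z n] times the martingale centres the functional, and a branch step then contracts
    its second moment by [mu^-1]. *)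
Lemma nearly_branching_L2_decay :
  geom_decay (fun n => E (fun t : tree A n => (mu ^- n * X t - z n * scaled_count [set: A]%SET t) ^+ 2)).
Proof.
pose U n (t : tree A n) := Z t - z n * scaled_count [set: A]%SET t.
(* The scaled count is an exact branch step, so beside the defect only the change of [z] enters the
   error. *)
pose e n (t : tree A n.+1) := @defect n t - (z n.+1 - z n) * @scaled_count [set: A]%SET n.+1 t.
have meanU n : E (@U n) = 0.
  rewrite (eq_tree_mean p (h := fun t => Z t + - z n * @scaled_count [set: A]%SET n t)).
    by rewrite tree_meanD [X in _ + X]tree_meanZ tree_mean_scaled_count ratioT expr1n mulr1 subrr.
  by move=> t; rewrite mulNr.
have US n (t : tree A n.+1) : U _ t = branch_step [set: A]%SET (@U n) t + e n t.
  have -> : branch_step [set: A]%SET (@U n) t =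
      branch_step [set: A]%SET (@Z n) t - z n * @scaled_count [set: A]%SET n.+1 t.
    rewrite scaled_countS /branch_step mulrCA -mulrBr; congr (_ * _).
    rewrite /branch_sum mulr_sumr -sumrB; apply: eq_bigr => a _.
    by rewrite mulrBr; congr (_ - _); rewrite mulrCA.
  by rewrite /U /e /defect; ring.
have [K K0 WK] := scaled_countT_L2_bounded.
have e_decay : geom_decay (fun n => E (fun t => e n t ^+ 2)).
  apply: (geom_decay_le (c := 2 * (1 + K))) defect_decay => [|n].
    by rewrite mulr_ge0// addr_ge0.
  apply: (@le_trans _ _ (2 * (E (fun t => @defect n t ^+ 2) +
      (z n.+1 - z n) ^+ 2 * E (fun t => @scaled_count [set: A]%SET n.+1 t ^+ 2)))).
    rewrite -!tree_meanZ -tree_meanD -tree_meanZ; apply: le_tree_mean => // t.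
    rewrite /e -exprMn; move: (@defect n t) (_ * scaled_count _ t) => x y.
    by have := sqr_ge0 (x + y); lra.
  rewrite -mulrA ler_wpM2l// mulrDl mul1r lerD2l z_increment mulrC.
  apply: ler_pM => //; [|exact: sqr_ge0|exact: sqr_tree_mean_le].
  by apply: tree_mean_ge0 => // t; exact: sqr_ge0.
(* Chosen so that [(1 + eta) / mu = (1 + mu^-1) / 2], which is below 1. *)
pose eta := (mu - 1) / 2.
have eta0 : 0 < eta by rewrite divr_gt0// subr_gt0.
apply: (@geom_decay_recursion _ ((1 + mu^-1) / 2) _
  (fun n => (1 + eta^-1) * E (fun t => e n t ^+ 2))) => [|||].
- by rewrite divr_ge0// addr_ge0// ltW.
- by rewrite ltr_pdivrMr// mul1r -[2]/(1 + 1) ltrD2l.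
- move=> n; rewrite -/(U _).
  apply: (@le_trans _ _ ((1 + eta) * E (fun t => branch_step [set: A]%SET (@U n) t ^+ 2) +
     (1 + eta^-1) * E (fun t => e n t ^+ 2))).
    rewrite -!tree_meanZ -tree_meanD; apply: le_tree_mean => // t.
    rewrite -/(U _ _) US; move: (branch_step _ _ _) (e n t) => x y.
    (* The bound [(x + y)^2 <= (1 + eta) x^2 + (1 + eta^-1) y^2] holds because the gap is a
       square. *)
    rewrite -subr_ge0 [X in 0 <= X](_ : _ = eta^-1 * (eta * x - y) ^+ 2).
      by rewrite mulr_ge0 ?sqr_ge0// invr_ge0 ltW.
    by field; rewrite gt_eqF.
  rewrite lerD2r.
  have -> : (1 + mu^-1) / 2 = (1 + eta) * mu^-1 by rewrite /eta; field.
  rewrite -mulrA ler_wpM2l//; first by rewrite addr_ge0// ltW.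
  apply: le_trans (tree_mean_branch_step_sqr _ _) _.
  by rewrite meanU mulr0 expr0n addr0 ratioT mul1r.
- apply: geom_decay_le e_decay => [|n]; last exact: lexx.
  by rewrite addr_ge0// invr_ge0 ltW.
Qed.

End nearly_branching_functional.
End branching_recursions.

(** * Law of the percolation tree and almost sure convergence *)

Lemma uniq_map_inj_in (S S' : eqType) (f : S -> S') (s : seq S) :
  uniq (map f s) -> {in s &, injective f}.
Proof.
elim: s => //= x s IHs /andP[fx us] y z; rewrite !inE.
move=> /predU1P[->|ys] /predU1P[->|zs] //= fE; last exact: IHs.
  by rewrite fE map_f in fx.
by rewrite -fE map_f in fx.
Qed.

Section tree_bits.
Variable A : finType.

(** The tree as a list of words with prescribed bits, the form to which independence applies. *)
Fixpoint tree_bits n : tree A n -> seq (seq A * bool) :=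
  if n is m.+1 then fun t : tree A m.+1 =>
    flatten [seq ([:: a], (t a).1) :: [seq (a :: x.1, x.2) | x <- tree_bits (t a).2] |
      a <- enum A]
  else fun=> [::].

Lemma tree_bits_neq0 n (t : tree A n) x : x \in tree_bits t -> x.1 != [::].
Proof.
case: n t => [|n] t //= /flattenP[_ /mapP[a _ ->]].
by rewrite inE => /predU1P[->//|/mapP[y _ ->]].
Qed.

Lemma uniq_tree_bits n (t : tree A n) : uniq [seq x.1 | x <- tree_bits t].
Proof.
elim: n t => [|n IHn] t //=.
rewrite map_flatten -map_comp.
rewrite (eq_map (g := fun a => [seq a :: s | s <- [::] :: [seq x.1 | x <- tree_bits (t a).2]])); last first.
  by move=> a /=; congr (_ :: _); rewrite -!map_comp.
apply: (@allpairs_uniq_dep A (fun=> seq A) _ (fun a s => a :: s)) => [|a _|].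
- exact: enum_uniq.
- rewrite /= IHn andbT; apply/mapP => -[x /tree_bits_neq0/negP h xE].
  by apply: h; rewrite -xE.
- by move=> [a s] [b r] _ _ /= [-> ->].
Qed.

Lemma tree_atP (y : seq A -> bool) n (t : tree A n) r :
  reflect (tree_at y n r = t) (all (fun x => y (r ++ x.1) == x.2) (tree_bits t)).
Proof.
elim: n t r => [|n IHn] t r /=; first by constructor; case: t.
have shift a : all (fun x => y (r ++ x.1) == x.2) [seq (a :: x.1, x.2) | x <- tree_bits (t a).2]
    = all (fun x => y (rcons r a ++ x.1) == x.2) (tree_bits (t a).2).
  by rewrite all_map; apply: eq_all => x /=; rewrite cat_rcons.
apply: (iffP allP) => [h|tE x /flattenP[_ /mapP[a _ ->]]].
  apply/ffunP => a; rewrite ffunE.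
  have ha x : x \in ([:: a], (t a).1) :: [seq (a :: x.1, x.2) | x <- tree_bits (t a).2] ->
      y (r ++ x.1) == x.2.
    by move=> xa; apply: h; apply/flattenP; eexists; [apply/mapP; exists a; rewrite ?mem_enum|].
  rewrite [RHS]surjective_pairing; congr (_, _).
    by have /eqP := ha _ (mem_head _ _); rewrite /= cats1.
  by apply/IHn; rewrite -shift; apply/allP => x xa; apply: ha; rewrite inE xa orbT.
rewrite inE => /predU1P[->|]; first by rewrite -tE ffunE /= cats1.
move: x; apply/allP; rewrite shift; apply/IHn.
by rewrite -tE ffunE.
Qed.

Lemma prod_tree_bits (R : realType) (p : R) n (t : tree A n) :
  \prod_(x <- tree_bits t) bit_weight p x.2 = tree_weight p t.
Proof.
elim: n t => [|n IHn] t /=; first by rewrite big_nil.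
rewrite big_flatten/= big_map big_enum/=; apply: eq_bigr => a _.
by rewrite big_cons big_map IHn.
Qed.

End tree_bits.

Section law_of_the_tree.
Context (disp : measure_display) (T : measurableType disp) (R : realType).
Context (P : probability T R) (d M : nat) (p : R).
Context (Y : seq (letter d M) -> {RV P >-> bool}).
Hypothesis p01 : 0 <= p <= 1.
Hypothesis hY : iid_bernoulli p Y.

Local Notation tr := (percolation_tree Y).

(** [mutually_independent] wants one set of bits for each word, whence this shape; since no word is
    listed twice, every set in the intersection is a singleton. *)
Lemma preimage_treeE n (t : tree (letter d M) n) :
  [set w | tr n w = t] =
  \big[setI/setT]_(s <- [seq x.1 | x <- tree_bits t])
    (Y s @^-1` [set b | (s, b) \in tree_bits t]).
Proof.
rewrite -bigcap_seq; apply/seteqP; split=> w /=.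
  move=> /tree_atP/allP h s /= /mapP[[s' b] xt ->].
  by have /eqP /= -> := h _ xt.
move=> h; apply/tree_atP/allP => -[s b] xt; apply/eqP.
have sbt : (s, Y s w) \in tree_bits t by apply: h; apply: (map_f (fun x => x.1) xt).
by have [] := uniq_map_inj_in (uniq_tree_bits t) sbt xt erefl.
Qed.

Lemma law_of_bit s b : s != [::] -> P (Y s @^-1` [set b]) = (bit_weight p b)%:E.
Proof.
move=> s0; have := hY.1 s s0 [set b]; rewrite /distribution /pushforward => ->.
by rewrite /bernoulli_prob p01 fsbig_set1; case: b.
Qed.

Lemma measurable_tree n (t : tree (letter d M) n) : measurable [set w | tr n w = t].
Proof.
rewrite preimage_treeE; apply: big_ind => // [|s _].
  exact: measurableI.
by rewrite -[X in measurable X]setTI; exact: measurable_funPT.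
Qed.

Lemma law_of_tree n (t : tree (letter d M) n) :
  P [set w | tr n w = t] = (tree_weight p t)%:E.
Proof.
rewrite preimage_treeE hY.2; last 3 first.
- exact: uniq_tree_bits.
- by move=> _ /mapP[x /tree_bits_neq0 ? ->].
- by [].
rewrite big_map -(prod_tree_bits p t) -prodEFin; apply: eq_big_seq => -[s b] xt /=.
rewrite (_ : [set c | _] = [set b]).
  by rewrite law_of_bit//; exact: tree_bits_neq0 xt.
apply/seteqP; split=> c /= => [ct|->//].
by have [] := uniq_map_inj_in (uniq_tree_bits t) ct xt erefl.
Qed.

(** As there are finitely many trees, a function of the tree is a simple function; its measurability
    and its mean follow from this. *)
Lemma tree_functionE n (g : tree (letter d M) n -> R) w :
  (g (tr n w))%:E = (\sum_t (g t)%:E * (\1_[set w | tr n w = t] w)%:E)%E.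
Proof.
rewrite (bigD1 (tr n w))//= indicE mem_set// mule1 big1 ?adde0// => t /eqP ht.
by rewrite indicE memNset ?mule0// => /esym.
Qed.

Lemma measurable_tree_function n (g : tree (letter d M) n -> R) :
  measurable_fun setT (fun w => g (tr n w)).
Proof.
apply/measurable_EFinP.
rewrite (_ : _ \o _ = fun w => \sum_t (g t)%:E * (\1_[set w | tr n w = t] w)%:E)%E.
  apply: emeasurable_sum => t; apply: emeasurable_funM => //.
  by apply/measurable_EFinP; apply: measurable_indic; exact: measurable_tree.
by apply/funext => w; rewrite /= tree_functionE.
Qed.

Lemma integral_tree_function n (g : tree (letter d M) n -> R) :
  (\int[P]_w (g (tr n w))%:E = (tree_mean p g)%:E)%E.
Proof.
have int1 t : P.-integrable setT (fun w => (\1_[set w | tr n w = t] w : R)%:E).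
  by apply/integrable_indic => //; exact: measurable_tree.
under eq_integral do rewrite tree_functionE.
rewrite integral_sum//; last by move=> t; exact: integrableZl.
rewrite /tree_mean -sumEFin; apply: eq_bigr => t _.
rewrite integralZl// integral_indic//; last exact: measurable_tree.
rewrite setIT mulrC EFinM; congr (_ * _)%E; exact: law_of_tree.
Qed.

Lemma expectation_tree_function n (g : tree (letter d M) n -> R) :
  ('E_P[fun w => g (tr n w)] = (tree_mean p g)%:E)%E.
Proof. by rewrite unlock integral_tree_function. Qed.

End law_of_the_tree.

(** By monotone convergence the sum of the series has a finite integral, so it is finite almost
    everywhere. *)
Lemma ae_cvg_series (disp : measure_display) (T : measurableType disp)
    (R : realType) (P : probability T R) (X : nat -> T -> R) (x : nat -> R) :
  (forall n, measurable_fun setT (X n)) -> (forall n w, 0 <= X n w) ->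
  (forall n, \int[P]_w (X n w)%:E = (x n)%:E)%E -> geom_decay x ->
  {ae P, forall w, cvgn (series (X ^~ w))}.
Proof.
move=> mX X0 intX xd.
have x0 n : 0 <= x n by rewrite -lee_fin -intX integral_ge0// => w _; rewrite lee_fin.
pose F w := (\sum_(n <oo) (X n w)%:E)%E.
have mX' n : measurable_fun setT (fun w => (X n w)%:E) by exact/measurable_EFinP.
have F0 w : (0 <= F w)%E by apply: nneseries_ge0 => n _ _; rewrite lee_fin.
have mF : measurable_fun setT F.
  by apply: ge0_emeasurable_sum => // n w _ _; rewrite lee_fin.
have intF : P.-integrable setT F.
  apply/integrableP; split=> //.
  under eq_integral do rewrite gee0_abs//.
  rewrite integral_nneseries//; last by move=> n w _; rewrite lee_fin.
  under eq_eseriesr do rewrite intX.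
  rewrite (_ : limn _ = (limn (series x))%:E) ?ltry//.
  rewrite -EFin_lim; last exact: geom_decay_series.
  by congr (limn _); apply/funext => n; rewrite /series/= sumEFin.
have [N [mN PN NF]] := integrable_ae measurableT intF.
exists N; split=> // w /= hw; apply: NF => /= /(_ I) Fw; apply: hw.
apply: nondecreasing_is_cvgn; first by apply: nondecreasing_series => n _ _; exact: X0.
exists (fine (F w)) => _ [n _ <-].
rewrite -lee_fin fineK// /series/= -sumEFin; apply: nneseries_lim_ge => m _ _.
by rewrite lee_fin.
Qed.

Section boundary_decay.
Variables (R : realType) (d M : nat) (p : R).
Hypothesis p01 : 0 <= p <= 1.
Hypothesis M2 : (2 <= M)%N.
Let mu : R := #|{: letter d M}|%:R * p.
Hypothesis mu1 : 1 < mu.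

Let M0 : (0 < M)%N. Proof. exact: ltn_trans M2. Qed.

Lemma face_letters_neqT i v : face_letters M i v != [set: letter d M]%SET.
Proof.
(* The digit of the opposite face, which differs from that of the given face because [2 <= M]. *)
have vM : ((if v then 0 else M.-1) < M)%N by case: v; lia.
apply/negP => /eqP/setP/(_ [ffun=> Ordinal vM]); rewrite !inE ffunE /=.
by case: v {vM} => /eqP; lia.
Qed.

(** The boundary count is dominated by the sum of the counts along the [2d] faces, each of which
    decays because its letters form a proper subset. *)
Lemma boundary_L2_decay :
  geom_decay (fun n => tree_mean p (fun t : tree (letter d M) n =>
    (mu ^- n * (count (on_boundary M n) (corners t))%:R) ^+ 2)).
Proof.
pose S n (t : tree (letter d M) n) := \sum_(x : 'I_d * bool)
   scaled_count p (face_letters M x.1 x.2) t.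
have S_decay : geom_decay (fun n => tree_mean p (fun t => S n t ^+ 2)).
  rewrite /S; elim: (index_enum _) => [|x s IHs].
    exists 0, 0; split=> // n; rewrite mul0r.
    rewrite (eq_tree_mean p (h := fun=> 0)) ?tree_mean_cst// => t.
    by rewrite big_nil expr0n.
  have hx := scaled_count_L2_decay mu1 (face_letters_neqT x.1 x.2).
  apply: (geom_decay_le (c := 1)) (L2_decayD p01 hx IHs) => // n.
  by rewrite mul1r; apply: le_tree_mean => // t; rewrite big_cons.
apply: (geom_decay_le (c := 1)) S_decay => // n; rewrite mul1r.
apply: le_tree_mean => // t.
have mun : 0 <= mu ^- n by rewrite invr_ge0 exprn_ge0// ltW// (lt_trans _ mu1).
have SE : S n t = mu ^- n * (\sum_(i < d) \sum_(v : bool) branch_count (face_letters M i v) t)%:R.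
  rewrite pair_bigA/= natr_sum mulr_sumr; exact: eq_bigr.
rewrite lerXn2r ?nnegrE ?mulr_ge0//; first by rewrite SE mulr_ge0.
by rewrite SE ler_wpM2l// ler_nat count_boundary.
Qed.

End boundary_decay.

(** Since [M^D = M^d p], the real power is a quotient of natural powers. *)
Lemma powR_dimD (R : realType) (d M : nat) (p : R) (k n : nat) :
  (2 <= M)%N -> 0 < p ->
  M%:R `^ ((k%:R - dimD d M p) * n%:R) = (M%:R ^+ n) ^+ k / (M%:R ^+ d * p) ^+ n.
Proof.
move=> M2 p0.
have M0 : 0 < M%:R :> R by rewrite ltr0n (ltn_trans _ M2).
have lnM : ln (M%:R : R) != 0 by rewrite gt_eqF// ln_gt0// ltr1n.
have mu0 : 0 < M%:R ^+ d * p by rewrite mulr_gt0// exprn_gt0.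
rewrite /powR gt_eqF//.
have -> : (k%:R - dimD d M p) * n%:R * ln M%:R = 
  (k%:R * ln M%:R - ln (M%:R ^+ d * p)) * n%:R.
  by rewrite /dimD; field.
rewrite mulrC expRM_natl expRD expRN lnK ?posrE// expRM_natl lnK ?posrE//.
by rewrite exprMn exprVn -!exprM mulnC.
Qed.

(** * Almost sure limits for the percolation *)

Section almost_sure_limit.
Context (disp : measure_display) (T : measurableType disp) (R : realType).
Context (P : probability T R) (d M : nat) (p : R).
Context (Y : seq (letter d M) -> {RV P >-> bool}).
Hypothesis M2 : (2 <= M)%N.
Hypothesis hp : M%:R ^- d < p <= 1.
Hypothesis hY : iid_bernoulli p Y.

Local Notation tr := (percolation_tree Y).
Local Notation mu := (#|{: letter d M}|%:R * p).

Let M0 : 0 < M%:R :> R. Proof. by rewrite ltr0n (ltn_trans _ M2). Qed.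

Let p0 : 0 < p.
Proof. by case/andP: hp => /(le_lt_trans _) -> //; rewrite invr_ge0 exprn_ge0// ltW. Qed.

Let p01 : 0 <= p <= 1.
Proof. by rewrite ltW//=; case/andP: hp. Qed.

Let muE : mu = M%:R ^+ d * p.
Proof. by rewrite card_ffun !card_ord natrX. Qed.

Let mu1 : 1 < mu.
Proof. by rewrite muE -ltr_pdivrMl ?exprn_gt0// mulr1; case/andP: hp. Qed.

Lemma W_martE n w : W_mart Y n w = scaled_count p [set: letter d M]%SET (tr n w).
Proof.
pose f n (t : tree (letter d M) n) : R := (branch_count [set: letter d M]%SET t)%:R.
have -> : W_mart Y n w = f n (tr n w) / fine ('E_P[fun w => f n (tr n w)]).
  rewrite /W_mart N_retainedE; congr (_ / fine 'E_P[_]).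
  by apply/funext => w'; exact: N_retainedE.
have mun : mu ^+ n != 0 by rewrite gt_eqF// exprn_gt0// (lt_trans _ mu1).
rewrite (expectation_tree_function p01 hY)/= (_ : tree_mean p (f n) = mu ^+ n).
  by rewrite mulrC.
have := tree_mean_scaled_count mu1 [set: letter d M]%SET n.
rewrite cardsT divff ?expr1n => [|]; last first.
  by apply: contraTneq mu1 => ->; rewrite mul0r -leNgt.
by rewrite tree_meanZ => /(canRL (mulKf _)) -> //; rewrite ?invr_eq0// invrK mulr1.
Qed.

Lemma trunc_tree n w : trunc (tr n.+1 w) = tr n w.
Proof.
rewrite /percolation_tree; elim: n [::] => [|n IHn] r //.
by apply/ffunP => a; rewrite !ffunE; exact: (congr1 (pair _) (IHn (rcons r a))).
Qed.

(** [abs_le_geom] turns the decay of second moments into a majorant of the absolute increments whose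
    series converges almost surely. *)
Lemma ae_cvg_W_mart : {ae P, forall w, cvgn (fun n => W_mart Y n w)}.
Proof.
pose D n : tree (letter d M) n.+1 -> R := @W_increment R (letter d M) p n.
have D0 n : 0 <= tree_mean p (fun t => D n t ^+ 2).
  by apply: tree_mean_ge0 => // t; exact: sqr_ge0.
have [s [s0 s1 hs]] := geom_decay_sqr D0 (W_increment_L2_decay mu1).
pose G n (t : tree (letter d M) n.+1) : R := s ^+ n + s ^- n * D n t ^+ 2.
have meanG : (fun n => tree_mean p (G n)) =
    fun n => s ^+ n + s ^- n * tree_mean p (fun t => D n t ^+ 2).
  apply/funext => n.
  by rewrite [LHS]tree_meanD tree_mean_cst [X in _ + X = _]tree_meanZ.
rewrite -meanG in hs.
have G0 n w : 0 <= G n (tr n.+1 w).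
  have sn : 0 <= s ^+ n by rewrite exprn_ge0// ltW.
  by apply: addr_ge0 => //; apply: mulr_ge0; [rewrite invr_ge0|exact: sqr_ge0].
have mG n : measurable_fun setT (fun w => G n (tr n.+1 w)).
  exact: measurable_tree_function.
have intG n := integral_tree_function p01 hY (G n).
apply: filterS (ae_cvg_series mG G0 intG hs) => w cG.
apply: cvg_series_increments; apply: (series_le_cvg _ (fun n => G0 n w) _ cG) => n //=.
by rewrite !W_martE -(trunc_tree n); exact: abs_le_geom.
Qed.

Variables (V : 'I_d.+1 -> set 'rV[R]_d -> R) (k : 'I_d.+1).
Hypothesis hV : additive_intrinsic_volumes V.

Let X n (t : tree (letter d M) n) : R := V k (cubes_set (corners t)).
Let B n (t : tree (letter d M) n) : R := (count (on_boundary M n) (corners t))%:R.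

Let XB n (t : tree (letter d M) n.+1) :
  `|X t - branch_sum [set: letter d M]%SET (@X n) t| <=
  2 * cell_bound V k * branch_sum [set: letter d M]%SET (@B n) t.
Proof.
have sumE (f : letter d M -> R) :
    \sum_(j in [set: letter d M]%SET) (t j).1%:R * f j = \sum_(j | (t j).1) f j.
  rewrite [RHS]big_mkcond; apply: eq_big => [j|j _]; first by rewrite inE.
  by case: (t j).1; rewrite ?mul1r ?mul0r.
rewrite /branch_sum !sumE mulr_sumr.
exact: valuation_tree_recursion.
Qed.

Lemma Z_rescaledE n w : Z_rescaled p Y V k n w = mu ^- n * X (tr n w).
Proof.
rewrite /Z_rescaled powR_dimD// muE valuation_F_step//; last by rewrite (ltn_trans _ M2).
rewrite mulrA [_ / _]mulrC mulfK// expf_neq0// expf_neq0// gt_eqF//.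
Qed.

Lemma mean_rescaledE n :
  mean_rescaled p Y V k n = tree_mean p (fun t : tree (letter d M) n => mu ^- n * X t).
Proof.
pose f (t : tree (letter d M) n) := (M%:R ^+ n) ^- k * X t.
rewrite /mean_rescaled (_ : (fun w => V k _) = fun w => f (tr n w)); last first.
  by apply/funext => w; rewrite valuation_F_step// (ltn_trans _ M2).
rewrite (expectation_tree_function p01 hY f)/= [n%:R * (_ - _)]mulrC powR_dimD// -muE.
rewrite !tree_meanZ mulrA; congr (_ * _).
by rewrite mulrAC divff ?mul1r// !expf_neq0// gt_eqF.
Qed.

Lemma cvg_mean_rescaled : cvgn (mean_rescaled p Y V k).
Proof.
rewrite (_ : mean_rescaled _ _ _ _ = fun n =>
  tree_mean p (fun t : tree (letter d M) n => mu ^- n * X t)).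
  exact: (cvg_nearly_branching_mean p01 mu1 XB (boundary_L2_decay p01 M2 mu1)).
by apply/funext => n; exact: mean_rescaledE.
Qed.

(** The rescaled valuation is [U n] plus the rescaled mean times the martingale. The squares of
    [U n] are almost surely summable, so [U n] tends to 0. *)
Lemma ae_cvg_Z_rescaled :
  {ae P, forall w, (fun n => Z_rescaled p Y V k n w) @ \oo --> Vbar p Y V k * W_infty Y w}.
Proof.
pose U n (t : tree (letter d M) n) : R := mu ^- n * X t -
  mean_rescaled p Y V k n * scaled_count p [set: letter d M]%SET t.
have U_decay : geom_decay (fun n => tree_mean p (fun t => U n t ^+ 2)).
  have := nearly_branching_L2_decay p01 mu1 XB (boundary_L2_decay p01 M2 mu1).
  by rewrite /U; under [X in geom_decay X -> _]eq_fun do rewrite -mean_rescaledE.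
have mU n : measurable_fun setT (fun w => U n (tr n w) ^+ 2).
  exact: (measurable_tree_function Y (fun t => U n t ^+ 2)).
have U0 n w : 0 <= U n (tr n w) ^+ 2 by exact: sqr_ge0.
have intU n := integral_tree_function p01 hY (fun t => U n t ^+ 2).
apply: filterS2 (ae_cvg_series mU U0 intU U_decay) ae_cvg_W_mart => w cU cW.
have U2 : (fun n => U n (tr n w) ^+ 2) @ \oo --> (0 : R) by exact: cvg_series_cvg_0.
have UE n : Z_rescaled p Y V k n w =
    U n (tr n w) + mean_rescaled p Y V k n * W_mart Y n w.
  by rewrite /U Z_rescaledE W_martE subrK.
rewrite (funext UE) -[Vbar _ _ _ _ * _]add0r; apply: cvgD; last first.
  by apply: cvgM => //; exact: cvg_mean_rescaled.
apply/norm_cvg0P.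
have -> : (fun n => `|U n (tr n w)|) = (fun n => Num.sqrt (U n (tr n w) ^+ 2)).
  by apply/funext => n; rewrite sqrtr_sqr.
have := continuous_cvg _ (@sqrt_continuous R 0) U2; rewrite sqrtr0 => h. exact: h.
Qed.

(* [W_infty] has a junk value where [W_mart] diverges, so its measurability is
   not immediate; the upper limit is always measurable. *)
Definition W_limsup (w : T) : R := fine (limn_esup (fun n => (W_mart Y n w)%:E)).

Lemma measurable_W_limsup : measurable_fun setT W_limsup.
Proof.
apply: measurableT_comp => //; apply: measurable_fun_limn_esup => n.
apply/measurable_EFinP; rewrite (funext (W_martE n)).
exact: (measurable_tree_function Y (scaled_count p [set: letter d M]%SET (n := n))).
Qed.

Lemma W_limsupE w : cvgn (fun n => W_mart Y n w) -> W_limsup w = W_infty Y w.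
Proof.
move=> cW; have cE : cvgn (fun n => (W_mart Y n w)%:E).
  by apply/cvg_ex; exists (limn (fun n => W_mart Y n w))%:E; exact: (cvg_comp _ _ cW).
rewrite /W_limsup (is_cvg_limn_esupE cE).
by have -> : limn (fun n => (W_mart Y n w)%:E) = (W_infty Y w)%:E by exact: EFin_lim.
Qed.

End almost_sure_limit.

Theorem theorem2p2 (R : realType) (d M : nat) (p : R)
    (hd : (1 <= d)%N) (hM : (2 <= M)%N) (hp : M%:R ^- d < p <= 1)
    (disp : measure_display) (T : measurableType disp) (P : probability T R)
    (Y : seq (letter d M) -> {RV P >-> bool}) (hY : iid_bernoulli p Y)
    (V : 'I_d.+1 -> set 'rV[R]_d -> R) (hV : additive_intrinsic_volumes V)
    (k : 'I_d.+1) :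
  [/\ cvgn (mean_rescaled p Y V k),
      {ae P, forall w, cvgn (fun n => W_mart Y n w)}
    & exists Zinf : {RV P >-> R},
        {ae P, forall w, (fun n => Z_rescaled p Y V k n w) @ \oo --> Zinf w} /\
        {ae P, forall w, Zinf w = Vbar p Y V k * W_infty Y w}].
Proof.
have cW := ae_cvg_W_mart hM hp hY.
have mZ : measurable_fun setT (fun w => Vbar p Y V k * W_limsup Y w).
  by apply: measurable_funM => //; exact: measurable_W_limsup hM hp hY.
split; [exact: cvg_mean_rescaled|exact: cW|].
(* The limit has to be a random variable, so it is built from the upper limit, which equals
   [W_infty] wherever the martingale converges. *)
pose Z := HB.pack_for {RV P >-> R} (fun w => Vbar p Y V k * W_limsup Y w)
  (isMeasurableFun.Build _ _ _ _ _ mZ).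
exists Z; split.
  have cZ := ae_cvg_Z_rescaled hM hp hY k hV.
  apply: filterS2 cW cZ => w cw.
  by rewrite -(W_limsupE cw).
by apply: filterS cW => w cw; rewrite -(W_limsupE cw).
Qed.
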